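(* Every stable group in continuous logic is definably amenable; that is, if $G$ is a group definable in a stable continuous theory $T$, then $G$ is definably amenable.
   Context: A formula $\varphi(x,y)$ is stable if for all sequences $(a_i)_{i<\omega}$, $(b_j)_{j<\omega}$ (in a model of $T$) for which the limits exist, $\lim_i\lim_j\varphi(a_i,b_j)=\lim_j\lim_i\varphi(a_i,b_j)$; $T$ is stable if all its formulas are stable. A definable group is a definable set with definable multiplication forming a group. $G$ is definably amenable if there is a linear functional $\mathfrak m$ on the unary definable predicates with parameters (considered on $G$) with $\mathfrak m(P)\ge0$ for $P\ge0$, $\mathfrak m(\mathbf 1)=1$ and $\mathfrak m(g\cdot P)=\mathfrak m(P)$ for all $g\in G$, where $(g\cdot P)(x)=P(g^{-1}x)$. *)

(* Defs.v *)
From Stdlib Require Import Reals Lra Arith Classical ClassicalEpsilon.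
From Stdlib Require Fin.
Open Scope R_scope.

Definition Rsup_set (E : R -> Prop) : R := epsilon (inhabits 0%R) (is_lub E).
Definition Rinf_set (E : R -> Prop) : R := - Rsup_set (fun r => E (- r)).

Record signature := {
  fsym : Type;  farity : fsym -> nat;  fmod : fsym -> R -> R;
  psym : Type;  parity : psym -> nat;  pmod : psym -> R -> R }.

Section Syntax.
Variable L : signature.

(* variables are natural numbers; argument lists are functions nat -> _,
   of which only the first (arity) entries matter *)
Inductive term : Type :=
| TVar : nat -> term
| TApp : forall f : fsym L, (nat -> term) -> term.

(* Formulas: d(t,s), P(ts), arbitrary continuous connectives
   u(phi_0,...,phi_{k-1}), sup_x, inf_x.  Formulas are real-valued
   (continuous connectives R^k -> R), so that definable predicates form a
   real vector space, as needed for linear functionals. *)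
Inductive formula : Type :=
| FDist : term -> term -> formula
| FPred : forall P : psym L, (nat -> term) -> formula
| FConn : nat -> ((nat -> R) -> R) -> (nat -> formula) -> formula
| FSup  : nat -> formula -> formula
| FInf  : nat -> formula -> formula.

Definition connective (k : nat) (u : (nat -> R) -> R) : Prop :=
  (forall v w, (forall i, (i < k)%nat -> v i = w i) -> u v = u w) /\
  (forall v eps, 0 < eps -> exists del, 0 < del /\
     forall w, (forall i, (i < k)%nat -> Rabs (v i - w i) < del) ->
       Rabs (u v - u w) < eps).

Fixpoint wf_formula (phi : formula) : Prop :=
  match phi with
  | FDist _ _ | FPred _ _ => True
  | FConn k u ps => connective k u /\ forall i, (i < k)%nat -> wf_formula (ps i)
  | FSup _ p | FInf _ p => wf_formula p
  end.
End Syntax.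

Arguments TVar {L}. Arguments TApp {L}.
Arguments FDist {L}. Arguments FPred {L}. Arguments FConn {L}.
Arguments FSup {L}. Arguments FInf {L}. Arguments wf_formula {L}.

Record structure (L : signature) := {
  carrier :> Type;
  point : carrier;
  dist : carrier -> carrier -> R;
  funi : forall f : fsym L, (nat -> carrier) -> carrier;
  predi : forall P : psym L, (nat -> carrier) -> R }.
Arguments point {L}. Arguments dist {L}. Arguments funi {L}. Arguments predi {L}.

Definition metric_structure {L} (M : structure L) : Prop :=
  (forall x y, 0 <= dist M x y <= 1) /\
  (forall x y, dist M x y = 0 <-> x = y) /\
  (forall x y, dist M x y = dist M y x) /\
  (forall x y z, dist M x z <= dist M x y + dist M y z) /\
  (forall s : nat -> M,
     (forall eps, 0 < eps -> exists N, forall m k, (N <= m)%nat -> (N <= k)%nat ->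
        dist M (s m) (s k) < eps) ->
     exists x, forall eps, 0 < eps -> exists N, forall m, (N <= m)%nat ->
        dist M (s m) x < eps) /\
  (forall f a b, (forall i, (i < farity L f)%nat -> a i = b i) ->
     funi M f a = funi M f b) /\
  (forall f eps, 0 < eps -> 0 < fmod L f eps /\
     forall a b, (forall i, (i < farity L f)%nat -> dist M (a i) (b i) < fmod L f eps) ->
       dist M (funi M f a) (funi M f b) <= eps) /\
  (forall P a, 0 <= predi M P a <= 1) /\
  (forall P a b, (forall i, (i < parity L P)%nat -> a i = b i) ->
     predi M P a = predi M P b) /\
  (forall P eps, 0 < eps -> 0 < pmod L P eps /\
     forall a b, (forall i, (i < parity L P)%nat -> dist M (a i) (b i) < pmod L P eps) ->
       Rabs (predi M P a - predi M P b) <= eps).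

Definition upd {M : Type} (v : nat -> M) (x : nat) (a : M) : nat -> M :=
  fun k => if Nat.eqb k x then a else v k.

Fixpoint teval {L} (M : structure L) (v : nat -> M) (t : term L) : M :=
  match t with
  | TVar k => v k
  | TApp f ts => funi M f (fun i => teval M v (ts i))
  end.

Fixpoint eval {L} (M : structure L) (v : nat -> M) (phi : formula L) : R :=
  match phi with
  | FDist t s => dist M (teval M v t) (teval M v s)
  | FPred P ts => predi M P (fun i => teval M v (ts i))
  | FConn _ u ps => u (fun i => eval M v (ps i))
  | FSup x p => Rsup_set (fun r => exists a : M, r = eval M (upd v x a) p)
  | FInf x p => Rinf_set (fun r => exists a : M, r = eval M (upd v x a) p)
  end.

Definition model {L} (M : structure L) (T : formula L -> Prop) : Prop :=
  metric_structure M /\ forall phi, T phi -> forall v, eval M v phi = 0.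

(* phi(x,y): the variables k with S k form x, the others form y *)
Definition mix {M : Type} (S : nat -> bool) (v w : nat -> M) : nat -> M :=
  fun k => if S k then v k else w k.

Definition stable_formula_in {L} (M : structure L) (phi : formula L)
    (S : nat -> bool) : Prop :=
  forall (a b : nat -> nat -> M) (li lj : nat -> R) (l1 l2 : R),
    (forall i, Un_cv (fun j => eval M (mix S (a i) (b j)) phi) (li i)) ->
    Un_cv li l1 ->
    (forall j, Un_cv (fun i => eval M (mix S (a i) (b j)) phi) (lj j)) ->
    Un_cv lj l2 ->
    l1 = l2.

Definition stable_theory {L} (T : formula L -> Prop) : Prop :=
  forall (M : structure L), model M T ->
  forall (phi : formula L) (S : nat -> bool), wf_formula phi ->
    stable_formula_in M phi S.

Definition tuple {L} (M : structure L) (n : nat) := Fin.t n -> M.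

Definition place {L} {M : structure L} (n off : nat) (a : tuple M n)
    (v : nat -> M) : nat -> M :=
  fun k => match le_lt_dec off k with
           | left _ => match lt_dec (k - off) n with
                       | left h => a (Fin.of_nat_lt h)
                       | right _ => v k
                       end
           | right _ => v k
           end.

Fixpoint dmax {L} (M : structure L) (n : nat) : tuple M n -> tuple M n -> R :=
  match n with
  | O => fun _ _ => 0
  | S m => fun a b => Rmax (dist M (a Fin.F1) (b Fin.F1))
                          (dmax M m (fun i => a (Fin.FS i)) (fun i => b (Fin.FS i)))
  end.

(* definable predicate in an n-tuple of variables x_0..x_{n-1}, with
   parameters from M: uniform limit of formulas phi(x, c) *)
Definition definable_pred {L} (M : structure L) (n : nat)
    (P : tuple M n -> R) : Prop :=
  forall eps, 0 < eps -> exists (phi : formula L) (c : nat -> M),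
    wf_formula phi /\
    forall a, Rabs (P a - eval M (place n 0 a c) phi) <= eps.

Definition definable_pred3 {L} (M : structure L) (n : nat)
    (Q : tuple M n -> tuple M n -> tuple M n -> R) : Prop :=
  forall eps, 0 < eps -> exists (phi : formula L) (c : nat -> M),
    wf_formula phi /\
    forall a b z, Rabs (Q a b z -
      eval M (place n 0 a (place n n b (place n (n + n) z c))) phi) <= eps.

Definition dist_to_set {L} (M : structure L) (n : nat)
    (D : tuple M n -> Prop) (a : tuple M n) : R :=
  Rinf_set (fun r => exists y, D y /\ r = dmax M n a y).

Definition definable_set {L} (M : structure L) (n : nat)
    (D : tuple M n -> Prop) : Prop :=
  (forall a, (forall eps, 0 < eps -> exists y, D y /\ dmax M n a y < eps) -> D a) /\
  definable_pred M n (dist_to_set M n D).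

(* definable group: a definable set G with multiplication mul : G x G -> G
   definable (d(x*y, z) is the restriction to G x G x M^n of a definable
   predicate), forming a group with identity e and inverse inv *)
Definition definable_group {L} (M : structure L) (n : nat)
    (G : tuple M n -> Prop) (mul : tuple M n -> tuple M n -> tuple M n)
    (inv : tuple M n -> tuple M n) (e : tuple M n) : Prop :=
  definable_set M n G /\
  (exists Q, definable_pred3 M n Q /\
     forall x y z, G x -> G y -> Q x y z = dmax M n (mul x y) z) /\
  G e /\
  (forall x y, G x -> G y -> G (mul x y)) /\
  (forall x, G x -> G (inv x)) /\
  (forall x y z, G x -> G y -> G z -> mul (mul x y) z = mul x (mul y z)) /\
  (forall x, G x -> mul e x = x /\ mul x e = x) /\
  (forall x, G x -> mul (inv x) x = e /\ mul x (inv x) = e).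

Definition definably_amenable {L} (M : structure L) (n : nat)
    (G : tuple M n -> Prop) (mul : tuple M n -> tuple M n -> tuple M n)
    (inv : tuple M n -> tuple M n) : Prop :=
  exists m : (tuple M n -> R) -> R,
    (forall P Q (s t : R), definable_pred M n P -> definable_pred M n Q ->
       m (fun x => s * P x + t * Q x) = s * m P + t * m Q) /\
    (forall P Q, definable_pred M n P -> definable_pred M n Q ->
       (forall x, G x -> P x = Q x) -> m P = m Q) /\
    (forall P, definable_pred M n P -> (forall x, G x -> 0 <= P x) -> 0 <= m P) /\
    m (fun _ => 1) = 1 /\
    (forall g P Q, G g -> definable_pred M n P -> definable_pred M n Q ->
       (forall x, G x -> Q x = P (mul (inv g) x)) -> m Q = m P).

(* Main.v *)
(** By stability and Grothendieck's double limit criterion, [f (x y)] has the double limit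
property on [G] for every definable predicate [f], where [P (x y)] is approximated by the
formulas [inf_z (P z + K d (x y, z))]. It remains to find a left-invariant mean on the
functions [f] with this property, which is the theorem of Ryll-Nardzewski on weakly almost
periodic functions; here is an elementary argument.

For a finite set [S] let [C] be a mean stationary for the random walk with steps in [S], a
limit of Cesaro averages. Then [h y = C (f (y .))] is harmonic, and it is enough that [h] be
constant along the walk: this makes [C] invariant under [S] on all such [f], and one lets [S]
grow along an ultrafilter. If [h] has positive variance at [x], one builds points [b_0, b_1,
...] of the walk such that [h (x b_i^-1 b_j)] stays, for all [j > i], above or below [h x] by a
fixed amount, according to a colour of [i] that may be prescribed once [b_i] is known: the old
martingales have almost stopped moving, the new one has not started. The colours are chosen so
that there are pairs [r_m], [p_m] of opposite colours for which [f (x b_(r_m)^-1 g) - f (x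
b_(p_m)^-1 g)] tends to [0] for every [g] in the semigroup. Its integral against the limit of
the means [b_j C] stays bounded away from [0], so along a subsequence any finitely many of them
are large at a common point, contradicting the double limit property. *)

From Stdlib Require Import Reals Lra Lia Arith List Classical ClassicalEpsilon FunctionalExtensionality.
From Stdlib Require Fin Cantor PropExtensionality.
From mathcomp Require filter.
Require Import Defs.
Import ListNotations.
Open Scope R_scope.
Set Bullet Behavior "Strict Subproofs".

(** * Ultrafilters and double limits *)

Lemma Rabs_le_bounds x B : Rabs x <= B -> - B <= x <= B.
Proof. intro H. pose proof (Rle_abs x). pose proof (Rle_abs (- x)). rewrite Rabs_Ropp in *. lra. Qed.

Record ultra {I : Type} (U : (I -> Prop) -> Prop) : Prop := {
  ultra_mono : forall A B : I -> Prop, U A -> (forall i, A i -> B i) -> U B;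
  ultra_and : forall A B : I -> Prop, U A -> U B -> U (fun i => A i /\ B i);
  ultra_ne : forall A : I -> Prop, U A -> exists i, A i;
  ultra_or : forall A : I -> Prop, U A \/ U (fun i => ~ A i) }.

(** The sets that contain a member of the base [F] form a proper filter, to which the ultrafilter
    lemma applies. *)
Lemma ultra_exists {I : Type} (F : (I -> Prop) -> Prop) :
  F (fun _ => True) ->
  (forall A B : I -> Prop, F A -> F B -> F (fun i => A i /\ B i)) ->
  (forall A : I -> Prop, F A -> exists i, A i) ->
  exists U, ultra U /\ forall A, F A -> U A.
Proof.
  intros HT HI HN.
  set (F' := fun A : I -> Prop => exists B, F B /\ forall i, B i -> A i).
  assert (HF' : filter.ProperFilter (T := I) F').
  { constructor.
    - intros [B [HB HB0]]. destruct (HN B HB) as [i Hi]. exact (HB0 i Hi).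
    - constructor.
      + exists (fun _ => True). split; [exact HT | easy].
      + intros A B [A' [HA HA']] [B' [HB HB']].
        exists (fun i => A' i /\ B' i). split; [now apply HI|].
        intros i [h1 h2]. split; auto.
      + intros A B HAB [A' [HA HA']]. exists A'. split; [assumption|].
        intros i Hi. apply HAB. auto. }
  destruct (filter.ultraFilterLemma HF') as [U [HU HFU]].
  exists U. split.
  - destruct (filter.ultra_proper (UltraFilter := HU)) as [Hne [HUT HUI HUS]].
    constructor.
    + intros A B HA HAB. exact (HUS A B HAB HA).
    + intros A B HA HB. exact (HUI A B HA HB).
    + intros A HA. apply NNPP. intro Hno. apply Hne.
      refine (HUS A _ _ HA). intros i Hi. apply Hno. now exists i.
    + intro A. exact (filter.in_ultra_setVsetC A HU).
  - intros A HA. apply HFU. now exists A.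
Qed.

Section Ultra.
Context {I : Type} (U : (I -> Prop) -> Prop) (HU : ultra U).

Lemma ultra_all (A : I -> Prop) : (forall i, A i) -> U A.
Proof.
  intro HA. destruct (ultra_or _ HU (fun _ => True)) as [h|h].
  - apply (ultra_mono _ HU _ _ h). auto.
  - destruct (ultra_ne _ HU _ h) as [i Hi]. tauto.
Qed.

Lemma ultra_list {X : Type} (l : list X) (P : X -> I -> Prop) :
  (forall x, In x l -> U (P x)) -> U (fun i => forall x, In x l -> P x i).
Proof.
  induction l as [|a l IH]; intro H.
  - apply ultra_all. intros i x [].
  - apply (ultra_mono _ HU (fun i => P a i /\ forall x, In x l -> P x i)).
    + apply (ultra_and _ HU); [apply H; now left|]. apply IH. intros x Hx. apply H. now right.
    + intros i [h1 h2] x [->|Hx]; auto.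
Qed.

Definition islim (p : I -> R) (x : R) : Prop :=
  forall eps, 0 < eps -> U (fun i => Rabs (p i - x) < eps).

Lemma islim_le p q x y :
  U (fun i => p i <= q i) -> islim p x -> islim q y -> x <= y.
Proof.
  intros Hpq Hp Hq. apply Rnot_lt_le. intro Hlt.
  destruct (ultra_ne _ HU _ (ultra_and _ HU _ _ Hpq (ultra_and _ HU _ _
    (Hp ((x - y) / 2) ltac:(lra)) (Hq ((x - y) / 2) ltac:(lra))))) as [i [h1 [h2 h3]]].
  apply Rabs_def2 in h2. apply Rabs_def2 in h3. lra.
Qed.

Lemma islim_unique p x y : islim p x -> islim p y -> x = y.
Proof.
  intros h1 h2. apply Rle_antisym; apply (islim_le p p); auto;
    apply ultra_all; intros; lra.
Qed.

Lemma islim_ext p q x : U (fun i => p i = q i) -> islim p x -> islim q x.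
Proof.
  intros H Hp eps He. apply (ultra_mono _ HU _ _ (ultra_and _ HU _ _ H (Hp eps He))).
  intros i [<- h]. exact h.
Qed.

Lemma islim_const c : islim (fun _ => c) c.
Proof. intros eps He. apply ultra_all. intros _. rewrite Rminus_diag, Rabs_R0. exact He. Qed.

Lemma islim_lin s t p q x y :
  islim p x -> islim q y -> islim (fun i => s * p i + t * q i) (s * x + t * y).
Proof.
  intros Hp Hq eps He.
  set (K := Rabs s + Rabs t + 1).
  assert (HK : 0 < K) by (unfold K; pose proof (Rabs_pos s); pose proof (Rabs_pos t); lra).
  assert (HeK : 0 < eps / K) by now apply Rdiv_lt_0_compat.
  apply (ultra_mono _ HU _ _ (ultra_and _ HU _ _ (Hp _ HeK) (Hq _ HeK))).
  intros i [h1 h2].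
  replace (s * p i + t * q i - (s * x + t * y)) with (s * (p i - x) + t * (q i - y)) by ring.
  eapply Rle_lt_trans; [apply Rabs_triang|]. rewrite !Rabs_mult.
  assert (Rabs s * Rabs (p i - x) <= Rabs s * (eps / K)) by
    (apply Rmult_le_compat_l; [apply Rabs_pos | lra]).
  assert (Rabs t * Rabs (q i - y) <= Rabs t * (eps / K)) by
    (apply Rmult_le_compat_l; [apply Rabs_pos | lra]).
  assert (K * (eps / K) = eps) by (field; lra).
  unfold K in *. lra.
Qed.

Lemma islim_minus p q x y : islim p x -> islim q y -> islim (fun i => p i - q i) (x - y).
Proof.
  intros Hp Hq. replace (x - y) with (1 * x + (-1) * y) by ring.
  apply (islim_ext (fun i => 1 * p i + (-1) * q i)).
  - apply ultra_all. intro. ring.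
  - now apply islim_lin.
Qed.

Lemma islim_exists p B : (forall i, Rabs (p i) <= B) -> exists x, islim p x.
Proof.
  intro HB.
  (* The limit is the supremum of the levels [r] that [p] reaches on a set of the ultrafilter. *)
  destruct (completeness (fun r => U (fun i => r <= p i))) as [x [Hub Hlub]].
  - exists B. intros r Hr. destruct (ultra_ne _ HU _ Hr) as [i Hi].
    specialize (HB i).
    pose proof (Rle_abs (p i)). lra.
  - exists (- B). apply ultra_all. intro i. specialize (HB i).
    pose proof (Rle_abs (- p i)). rewrite Rabs_Ropp in *. lra.
  - exists x. intros eps He.
    destruct (ultra_or _ HU (fun i => x + eps <= p i)) as [h|h].
    + specialize (Hub _ h). lra.
    + destruct (ultra_or _ HU (fun i => x - eps < p i)) as [h'|h'].
      * apply (ultra_mono _ HU _ _ (ultra_and _ HU _ _ h h')).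
        intros i [h1 h2]. apply Rabs_def1; lra.
      * exfalso. assert (x <= x - eps); [|lra].
        apply Hlub. intros r Hr. apply Rnot_lt_le. intro Hlt.
        destruct (ultra_ne _ HU _ (ultra_and _ HU _ _ h' Hr)) as [i [h1 h2]]. lra.
Qed.

(** Made total by choice: the value is meaningful when the limit exists, in particular for bounded
    [p]. *)
Definition ulim (p : I -> R) : R := epsilon (inhabits 0) (islim p).

Lemma ulimP p B : (forall i, Rabs (p i) <= B) -> islim p (ulim p).
Proof. intro HB. unfold ulim. apply epsilon_spec. now apply (islim_exists p B). Qed.

Lemma islim_ulim p x : islim p x -> ulim p = x.
Proof.
  intro H. apply (islim_unique p); [|exact H]. unfold ulim. apply epsilon_spec. now exists x.
Qed.

Lemma islim_bound p x B : (forall i, Rabs (p i) <= B) -> islim p x -> Rabs x <= B.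
Proof.
  intros HB Hp. apply Rabs_le. split.
  - apply (islim_le (fun _ => - B) p); [|apply islim_const|exact Hp].
    apply ultra_all. intro i. specialize (HB i). pose proof (Rle_abs (- p i)).
    rewrite Rabs_Ropp in *. lra.
  - apply (islim_le p (fun _ => B)); [|exact Hp|apply islim_const].
    apply ultra_all. intro i. specialize (HB i). pose proof (Rle_abs (p i)). lra.
Qed.

Lemma ulim_bound p B : (forall i, Rabs (p i) <= B) -> Rabs (ulim p) <= B.
Proof. intro HB. apply (islim_bound p); [exact HB|]. now apply (ulimP p B). Qed.

End Ultra.

Definition nonprincipal (U : (nat -> Prop) -> Prop) : Prop :=
  ultra U /\ forall N, U (fun i => (N <= i)%nat).

Lemma nonprincipal_containing (P : nat -> Prop) :
  (forall N, exists i, (N <= i)%nat /\ P i) -> exists U, nonprincipal U /\ U P.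
Proof.
  intro HP.
  destruct (ultra_exists (fun A : nat -> Prop =>
    exists N, forall i, (N <= i)%nat -> P i -> A i)) as [U [HU HF]].
  - exists 0%nat. auto.
  - intros A B [N HN] [N' HN']. exists (Nat.max N N'). intros i Hi Hp.
    split; [apply HN|apply HN']; auto; lia.
  - intros A [N HN]. destruct (HP N) as [i [Hi Hp]]. exists i. auto.
  - exists U. split; [split; [exact HU|]|]; intros; apply HF.
    + exists N. auto.
    + exists 0%nat. auto.
Qed.

Lemma nonprincipal_exists : exists U, nonprincipal U.
Proof.
  destruct (nonprincipal_containing (fun _ => True)) as [U [HU _]].
  - intro N. now exists N.
  - now exists U.
Qed.

Lemma islim_cv U p x : nonprincipal U -> Un_cv p x -> islim U p x.
Proof.
  intros [HU HT] Hp eps He. destruct (Hp eps He) as [N HN].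
  apply (ultra_mono _ HU _ _ (HT N)). intros i Hi. now apply HN.
Qed.

Fixpoint hist {A : Type} (s : nat -> A) (n : nat) : list A :=
  match n with O => [] | S n => s n :: hist s n end.

Lemma in_hist {A : Type} (s : nat -> A) n a : In a (hist s n) <-> exists k, (k < n)%nat /\ a = s k.
Proof.
  induction n as [|n IH]; simpl.
  - split; [easy|]. intros [k [hk _]]. lia.
  - rewrite IH. split.
    + intros [<-|[k [hk ->]]]; [exists n|exists k]; split; auto; lia.
    + intros [k [hk ->]]. destruct (Nat.eq_dec k n) as [->|]; [now left|].
      right. exists k. split; auto; lia.
Qed.

Lemma hist_length {A : Type} (s : nat -> A) n : length (hist s n) = n.
Proof. induction n; simpl; auto. Qed.

(** Dependent choice in which each new term may depend on all earlier ones; histories are stored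
    newest first. *)
Lemma history_choice {A : Type} (Inv : list A -> Prop) :
  Inv [] -> (forall l, Inv l -> exists a, Inv (a :: l)) ->
  exists s : nat -> A, forall n, Inv (hist s n).
Proof.
  intros H0 Hstep.
  assert (step : forall l : {l | Inv l}, {a | Inv (a :: proj1_sig l)}).
  { intros [l Hl]. apply constructive_indefinite_description. now apply Hstep. }
  set (st := fix st (n : nat) : {l | Inv l} :=
    match n with
    | O => exist _ [] H0
    | S n => exist Inv (proj1_sig (step (st n)) :: proj1_sig (st n)) (proj2_sig (step (st n)))
    end).
  exists (fun n => proj1_sig (step (st n))).
  assert (E : forall n, hist (fun n => proj1_sig (step (st n))) n = proj1_sig (st n)).
  { induction n as [|n IH]; simpl; [reflexivity|]. now rewrite IH. }
  intro n. rewrite E. apply proj2_sig.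
Qed.

(** Grothendieck's condition in the form of [stable_formula_in]: only sequences for which all the
    limits exist are tested. *)
Definition double_limit {X Y : Type} (F : X -> Y -> R) : Prop :=
  forall (a : nat -> X) (b : nat -> Y) (li lj : nat -> R) (l1 l2 : R),
    (forall i, Un_cv (fun j => F (a i) (b j)) (li i)) -> Un_cv li l1 ->
    (forall j, Un_cv (fun i => F (a i) (b j)) (lj j)) -> Un_cv lj l2 -> l1 = l2.

Lemma inv_INR_pos n : 0 < / (INR n + 1).
Proof. apply Rinv_0_lt_compat. pose proof (pos_INR n). lra. Qed.

Lemma cv_of_rate p x K :
  (forall n, (K <= n)%nat -> Rabs (p n - x) < / (INR n + 1)) -> Un_cv p x.
Proof.
  intros H eps He. destruct (archimed_cor1 eps He) as [N [HN HN0]].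
  exists (Nat.max N K). intros n Hn. unfold Rdist.
  eapply Rlt_trans; [apply H; lia|]. eapply Rlt_trans; [|exact HN].
  apply Rinv_lt_contravar.
  - apply lt_0_INR in HN0. apply Rmult_lt_0_compat; [assumption|]. pose proof (pos_INR n). lra.
  - assert (INR N <= INR n) by (apply le_INR; lia). lra.
Qed.

(* Grothendieck's exchange of limits along ultrafilters reduces to sequences: points [x_k],
   [y_k] are chosen alternately, each pair approximating the relevant limits of all earlier
   ones to within [1/(k+1)]. *)
Lemma double_limit_ultra {X Y : Type} (F : X -> Y -> R) U W phi psi alpha beta :
  double_limit F -> ultra U -> ultra W ->
  (forall x, islim W (F x) (phi x)) -> islim U phi alpha ->
  (forall y, islim U (fun x => F x y) (psi y)) -> islim W psi beta ->
  alpha = beta.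
Proof.
  intros HF HU HW Hphi Halpha Hpsi Hbeta.
  set (ok := fun (p : X * Y) (l : list (X * Y)) => let d := / (INR (length l) + 1) in
    Rabs (phi (fst p) - alpha) < d /\ Rabs (psi (snd p) - beta) < d /\
    (forall q, In q l -> Rabs (F (fst p) (snd q) - psi (snd q)) < d) /\
    (forall q, In q (p :: l) -> Rabs (F (fst q) (snd p) - phi (fst q)) < d)).
  destruct (history_choice (fun l => match l with [] => True | p :: l => ok p l end)) as [s Hs].
  { exact Logic.I. }
  { intros l _. set (d := / (INR (length l) + 1)). assert (Hd : 0 < d) by apply inv_INR_pos.
    destruct (ultra_ne _ HU _ (ultra_and _ HU _ _ (Halpha d Hd)
      (ultra_list U HU l (fun q x => Rabs (F x (snd q) - psi (snd q)) < d)
        (fun q _ => Hpsi (snd q) d Hd)))) as [x [h1 h2]].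
    destruct (ultra_ne _ HW _ (ultra_and _ HW _ _ (ultra_and _ HW _ _ (Hbeta d Hd) (Hphi x d Hd))
      (ultra_list W HW l (fun q y => Rabs (F (fst q) y - phi (fst q)) < d)
        (fun q _ => Hphi (fst q) d Hd)))) as [y [[h3 h4] h5]].
    exists (x, y). unfold ok. fold d. simpl. repeat split; auto.
    intros q [<-|Hq]; auto. }
  assert (Hok : forall n, ok (s n) (hist s n)) by (intro n; exact (Hs (S n))).
  unfold ok in Hok.
  apply (HF (fun n => fst (s n)) (fun n => snd (s n)) (fun n => phi (fst (s n)))
    (fun n => psi (snd (s n)))).
  - intro i. apply (cv_of_rate _ _ i). intros n Hn.
    destruct (Hok n) as (_ & _ & _ & h). rewrite hist_length in h.
    apply h. destruct (Nat.eq_dec i n) as [->|]; [now left|right].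
    apply in_hist. exists i. split; auto; lia.
  - apply (cv_of_rate _ _ 0). intros n _. destruct (Hok n) as (h & _).
    now rewrite hist_length in h.
  - intro j. apply (cv_of_rate _ _ (S j)). intros n Hn.
    destruct (Hok n) as (_ & _ & h & _). rewrite hist_length in h.
    apply h. apply in_hist. exists j. split; auto.
  - apply (cv_of_rate _ _ 0). intros n _. destruct (Hok n) as (_ & h & _).
    now rewrite hist_length in h.
Qed.

(** * Means and random walks *)

Definition bdd {X : Type} (p : X -> R) : Prop := exists B, forall x, Rabs (p x) <= B.

Lemma bdd_const {X : Type} c : bdd (fun _ : X => c).
Proof. exists (Rabs c). intros. lra. Qed.

Lemma bdd_comp {X Y : Type} (p : Y -> R) (k : X -> Y) : bdd p -> bdd (fun x => p (k x)).
Proof. intros [B HB]. exists B. auto. Qed.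

Lemma bdd_plus {X : Type} (p q : X -> R) : bdd p -> bdd q -> bdd (fun x => p x + q x).
Proof.
  intros [B HB] [B' HB']. exists (B + B'). intro x.
  eapply Rle_trans; [apply Rabs_triang|]. specialize (HB x). specialize (HB' x). lra.
Qed.

Lemma bdd_mult {X : Type} (p q : X -> R) : bdd p -> bdd q -> bdd (fun x => p x * q x).
Proof.
  intros [B HB] [B' HB']. exists (B * B'). intro x. rewrite Rabs_mult.
  apply Rmult_le_compat; auto using Rabs_pos.
Qed.

Lemma bdd_minus {X : Type} (p q : X -> R) : bdd p -> bdd q -> bdd (fun x => p x - q x).
Proof.
  intros [B HB] [B' HB']. exists (B + B'). intro x.
  replace (p x - q x) with (p x + - q x) by ring.
  eapply Rle_trans; [apply Rabs_triang|]. rewrite Rabs_Ropp.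
  specialize (HB x). specialize (HB' x). lra.
Qed.

Lemma bdd_div {X : Type} (p : X -> R) c : bdd p -> bdd (fun x => p x / c).
Proof. intro H. apply bdd_mult; [exact H|apply bdd_const]. Qed.

#[local] Hint Resolve bdd_const bdd_plus bdd_mult bdd_minus bdd_div : bdd.

(** A finitely additive probability carried by [Z]. The functional is total, but its laws concern
    bounded functions; that it is carried by [Z] is expressed by comparing functions on [Z]
    alone. *)
Record mean {X : Type} (Z : X -> Prop) (C : (X -> R) -> R) : Prop := {
  mean_lin : forall s t p q, bdd p -> bdd q ->
    C (fun x => s * p x + t * q x) = s * C p + t * C q;
  mean_mono : forall p q, bdd p -> bdd q -> (forall x, Z x -> p x <= q x) -> C p <= C q;
  mean_one : C (fun _ => 1) = 1 }.

Section Mean.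
Context {X : Type} {Z : X -> Prop} {C : (X -> R) -> R} (HC : mean Z C).

Lemma mean_const c : C (fun _ => c) = c.
Proof.
  replace (fun _ : X => c) with (fun _ : X => c * 1 + 0 * 1)
    by (apply functional_extensionality; intro; ring).
  rewrite (mean_lin _ _ HC c 0 (fun _ => 1) (fun _ => 1)), (mean_one _ _ HC) by auto with bdd. ring.
Qed.

Lemma mean_plus p q : bdd p -> bdd q -> C (fun x => p x + q x) = C p + C q.
Proof.
  intros. replace (fun x => p x + q x) with (fun x => 1 * p x + 1 * q x)
    by (apply functional_extensionality; intro; ring).
  rewrite (mean_lin _ _ HC) by assumption. ring.
Qed.

Lemma mean_minus p q : bdd p -> bdd q -> C (fun x => p x - q x) = C p - C q.
Proof.
  intros. replace (fun x => p x - q x) with (fun x => 1 * p x + (-1) * q x)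
    by (apply functional_extensionality; intro; ring).
  rewrite (mean_lin _ _ HC) by assumption. ring.
Qed.

Lemma mean_scal c p : bdd p -> C (fun x => c * p x) = c * C p.
Proof.
  intros. replace (fun x => c * p x) with (fun x => c * p x + 0 * p x)
    by (apply functional_extensionality; intro; ring).
  rewrite (mean_lin _ _ HC) by assumption. ring.
Qed.

Lemma mean_div c p : bdd p -> C (fun x => p x / c) = C p / c.
Proof.
  intro. replace (fun x => p x / c) with (fun x => / c * p x)
    by (apply functional_extensionality; intro; unfold Rdiv; ring).
  rewrite mean_scal by assumption. unfold Rdiv. ring.
Qed.

Lemma mean_bound p B : (forall x, Rabs (p x) <= B) -> Rabs (C p) <= B.
Proof.
  intro HB. assert (bdd p) by now exists B.
  apply Rabs_le. rewrite <- (mean_const (- B)), <- (mean_const B) at 1.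
  split; apply (mean_mono _ _ HC); auto with bdd; intros x _; specialize (HB x);
    pose proof (Rle_abs (p x)); pose proof (Rle_abs (- p x)); rewrite Rabs_Ropp in *; lra.
Qed.

Lemma mean_ge0 p : bdd p -> (forall x, Z x -> 0 <= p x) -> 0 <= C p.
Proof.
  intros Hp H. rewrite <- (mean_const 0). apply (mean_mono _ _ HC); auto with bdd.
Qed.

End Mean.

Lemma mean_ulim {I X : Type} U (Z : X -> Prop) (C : I -> (X -> R) -> R) :
  ultra U -> (forall i, mean Z (C i)) -> mean Z (fun p => ulim U (fun i => C i p)).
Proof.
  intros HU HC.
  assert (Hl : forall p, bdd p -> islim U (fun i => C i p) (ulim U (fun i => C i p))).
  { intros p [B HB]. apply (ulimP U HU _ B). intro i. now apply (mean_bound (HC i)). }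
  constructor.
  - intros s t p q Hp Hq. apply (islim_ulim U HU).
    apply (islim_ext U HU (fun i => s * C i p + t * C i q)).
    + apply (ultra_all U HU). intro i. symmetry. now apply (mean_lin _ _ (HC i)).
    + apply (islim_lin U HU); auto.
  - intros p q Hp Hq H. apply (islim_le U HU (fun i => C i p) (fun i => C i q)); auto.
    apply (ultra_all U HU). intro i. now apply (mean_mono _ _ (HC i)).
  - apply (islim_ulim U HU). apply (islim_ext U HU (fun _ => 1)).
    + apply (ultra_all U HU). intro i. symmetry. apply (mean_one _ _ (HC i)).
    + apply (islim_const U HU).
Qed.

Definition lsum {X : Type} (l : list X) (p : X -> R) : R :=
  fold_right (fun x acc => p x + acc) 0 l.

Lemma lsum_lin {X : Type} (l : list X) s t p q :
  lsum l (fun x => s * p x + t * q x) = s * lsum l p + t * lsum l q.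
Proof. induction l as [|a l IH]; simpl; [ring|]. rewrite IH. ring. Qed.

Lemma lsum_mono {X : Type} (l : list X) p q :
  (forall x, In x l -> p x <= q x) -> lsum l p <= lsum l q.
Proof.
  induction l as [|a l IH]; simpl; intro H; [lra|].
  apply Rplus_le_compat; auto.
Qed.

Lemma lsum_const {X : Type} (l : list X) c : lsum l (fun _ => c) = INR (length l) * c.
Proof.
  induction l as [|a l IH]; cbn [lsum fold_right length]; [simpl; ring|].
  fold (lsum l (fun _ : X => c)). rewrite IH, S_INR. ring.
Qed.

Lemma lsum_ge_term {X : Type} (l : list X) p x :
  (forall y, In y l -> 0 <= p y) -> In x l -> p x <= lsum l p.
Proof.
  intros H. induction l as [|a l IH]; simpl; [easy|].
  assert (0 <= lsum l p).
  { rewrite <- (Rmult_0_r (INR (length l))), <- lsum_const. apply lsum_mono.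
    intros y Hy. apply H. now right. }
  assert (0 <= p a) by (apply H; now left).
  intros [->|Hx]; [fold (lsum l p); lra|].
  assert (p x <= lsum l p) by (apply IH; auto; intros; apply H; now right).
  fold (lsum l p). lra.
Qed.

Lemma bdd_lsum {X Y : Type} (l : list Y) (p : Y -> X -> R) :
  (forall y, bdd (p y)) -> bdd (fun x => lsum l (fun y => p y x)).
Proof. intro H. induction l as [|a l IH]; simpl; auto with bdd. Qed.

Lemma mean_lsum {X Y : Type} {Z : X -> Prop} {C} (HC : mean Z C) (l : list Y) (p : Y -> X -> R) :
  (forall y, bdd (p y)) -> C (fun x => lsum l (fun y => p y x)) = lsum l (fun y => C (p y)).
Proof.
  intro H. induction l as [|a l IH]; simpl; [apply (mean_const HC)|].
  rewrite <- IH. apply (mean_plus HC); [auto|]. now apply bdd_lsum.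
Qed.

Lemma islim_lsum {I X : Type} U (l : list X) (p : X -> I -> R) (c : X -> R) :
  ultra U -> (forall x, islim U (p x) (c x)) ->
  islim U (fun i => lsum l (fun x => p x i)) (lsum l c).
Proof.
  intros HU H. induction l as [|a l IH]; simpl; [apply (islim_const U HU)|].
  apply (islim_ext U HU (fun i => 1 * p a i + 1 * lsum l (fun x => p x i))).
  - apply (ultra_all U HU). intro. unfold lsum. ring.
  - replace (c a + _) with (1 * c a + 1 * lsum l c) by (unfold lsum; ring).
    now apply (islim_lin U HU).
Qed.

(** * Random walks on a group and their stationary means *)

Record group_laws {G : Type} (mul : G -> G -> G) (one : G) (inv : G -> G) : Prop := {
  grp_assoc : forall x y z, mul (mul x y) z = mul x (mul y z);
  grp_one_l : forall x, mul one x = x;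
  grp_one_r : forall x, mul x one = x;
  grp_inv_l : forall x, mul (inv x) x = one;
  grp_inv_r : forall x, mul x (inv x) = one }.

Section Walk.
Context {G : Type} {mul : G -> G -> G} {one : G} {inv : G -> G}
  (HG : group_laws mul one inv) (S : list G) (HS : S <> []).
Local Notation "x ** y" := (mul x y) (at level 40, left associativity).

Definition avg (p : G -> R) : R := lsum S p / INR (length S).

Lemma length_pos : 0 < INR (length S).
Proof. destruct S; [easy|]. apply lt_0_INR. simpl. lia. Qed.

Lemma mean_avg : mean (fun s => In s S) avg.
Proof.
  pose proof length_pos. unfold avg. constructor.
  - intros. rewrite lsum_lin. field. lra.
  - intros. apply Rmult_le_compat_r; [left; now apply Rinv_0_lt_compat|]. now apply lsum_mono.
  - rewrite lsum_const. field. lra.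
Qed.

Lemma bdd_avg {X : Type} (p : X -> G -> R) :
  bdd (fun z => p (fst z) (snd z)) -> bdd (fun x => avg (p x)).
Proof.
  intros [B HB]. exists B. intro x. apply (mean_bound mean_avg).
  intro g. exact (HB (x, g)).
Qed.

Lemma bdd_avg_mul (p : G -> R) : bdd p -> bdd (fun w => avg (fun s => p (w ** s))).
Proof. intro H. apply (bdd_avg (fun w s => p (w ** s))). now apply (bdd_comp p (fun z => fst z ** snd z)). Qed.

(** The semigroup generated by [S], without inverses: the points that the walk from the identity can
    reach. *)
Inductive gen : G -> Prop :=
| gen_one : gen one
| gen_snoc g s : gen g -> In s S -> gen (g ** s).

Lemma gen_mul a b : gen a -> gen b -> gen (a ** b).
Proof.
  intros Ha Hb. induction Hb as [|b s Hb IH Hs].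
  - now rewrite (grp_one_r _ _ _ HG).
  - rewrite <- (grp_assoc _ _ _ HG). now apply gen_snoc.
Qed.

(** The expectation of [p] after [n] independent uniform steps from [S], each multiplied on the
    right; that is, the integral against a convolution power. *)
Fixpoint walk (n : nat) (p : G -> R) : R :=
  match n with
  | O => p one
  | Datatypes.S n => walk n (fun w => avg (fun s => p (w ** s)))
  end.

Lemma mean_walk n : mean gen (walk n).
Proof.
  induction n as [|n IH]; simpl.
  - constructor; auto. intros p q _ _ H. apply H, gen_one.
  - constructor.
    + intros s t p q Hp Hq.
      rewrite <- (mean_lin _ _ IH) by now apply bdd_avg_mul.
      f_equal. apply functional_extensionality. intro w.
      apply (mean_lin _ _ mean_avg s t (fun g => p (w ** g)) (fun g => q (w ** g)));
        now apply (bdd_comp _ (mul w)).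
    + intros p q Hp Hq H. apply (mean_mono _ _ IH); try now apply bdd_avg_mul.
      intros w Hw. apply (mean_mono _ _ mean_avg); try now apply (bdd_comp _ (mul w)).
      intros s Hs. apply H. now apply gen_snoc.
    + transitivity (walk n (fun _ => 1)); [|apply (mean_one _ _ IH)].
      f_equal. apply functional_extensionality. intro w. apply (mean_one _ _ mean_avg).
Qed.

(** Convolution powers commute with one another, so the first step can be split off instead of the
    last one. *)
Lemma walk_first n p : walk (Datatypes.S n) p = avg (fun s => walk n (fun w => p (s ** w))).
Proof.
  revert p. induction n as [|n IH]; intro p; simpl.
  - f_equal. apply functional_extensionality. intro s.
    now rewrite (grp_one_l _ _ _ HG), (grp_one_r _ _ _ HG).
  - specialize (IH (fun w => avg (fun s => p (w ** s)))). simpl in IH. rewrite IH.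
    f_equal. apply functional_extensionality. intro s.
    f_equal. apply functional_extensionality. intro w.
    f_equal. apply functional_extensionality. intro t.
    now rewrite (grp_assoc _ _ _ HG).
Qed.

Definition cesaro (k : nat) (p : G -> R) : R := lsum (seq 0 (Datatypes.S k)) (fun i => walk i p) / INR (Datatypes.S k).

Lemma mean_cesaro k : mean gen (cesaro k).
Proof.
  assert (Hk : 0 < INR (Datatypes.S k)) by (apply lt_0_INR; lia).
  unfold cesaro. constructor.
  - intros s t p q Hp Hq.
    replace (fun i => walk i (fun x => s * p x + t * q x)) with (fun i => s * walk i p + t * walk i q).
    + rewrite lsum_lin. field. lra.
    + apply functional_extensionality. intro i. symmetry. now apply (mean_lin _ _ (mean_walk i)).
  - intros p q Hp Hq H. apply Rmult_le_compat_r; [left; now apply Rinv_0_lt_compat|].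
    apply lsum_mono. intros i _. now apply (mean_mono _ _ (mean_walk i)).
  - replace (fun i => walk i (fun _ => 1)) with (fun _ : nat => 1).
    + rewrite lsum_const, length_seq. field. lra.
    + apply functional_extensionality. intro i. symmetry. apply (mean_one _ _ (mean_walk i)).
Qed.

(** Averaging over a first step moves every time one unit ahead, so the two sums telescope and only
    the two extreme times remain. *)
Lemma cesaro_shift k p :
  avg (fun s => cesaro k (fun w => p (s ** w))) - cesaro k p =
  (walk (Datatypes.S k) p - walk 0 p) / INR (Datatypes.S k).
Proof.
  assert (Hk : 0 < INR (Datatypes.S k)) by (apply lt_0_INR; lia).
  assert (E : forall m, avg (fun s => lsum (seq 0 m) (fun i => walk i (fun w => p (s ** w))))
      = lsum (seq 0 m) (fun i => walk i p) + walk m p - walk 0 p).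
  { assert (snoc : forall m (q : nat -> R), lsum (seq 0 (Datatypes.S m)) q = lsum (seq 0 m) q + q m).
    { intros m q. rewrite seq_S. unfold lsum. rewrite fold_right_app. simpl.
      generalize (seq 0 m). intro l. induction l as [|a l IH]; simpl; [ring|]. rewrite IH. ring. }
    induction m as [|m IH].
    - change (lsum S (fun _ => 0) / INR (length S) = 0 + walk 0 p - walk 0 p).
      rewrite lsum_const. unfold Rdiv. ring.
    - rewrite snoc.
      replace (fun s => lsum (seq 0 (Datatypes.S m)) (fun i => walk i (fun w => p (s ** w)))) with
        (fun s => 1 * lsum (seq 0 m) (fun i => walk i (fun w => p (s ** w)))
                + 1 * walk m (fun w => p (s ** w)))
        by (apply functional_extensionality; intro; rewrite snoc; ring).
      unfold avg. rewrite lsum_lin. unfold Rdiv. rewrite Rmult_plus_distr_r, !Rmult_1_l.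
      pose proof (walk_first m p) as W. unfold avg, Rdiv in W, IH. rewrite <- W, IH. ring. }
  unfold cesaro.
  replace (avg (fun s => lsum (seq 0 (Datatypes.S k)) (fun i => walk i (fun w => p (s ** w))) / INR (Datatypes.S k)))
    with (avg (fun s => lsum (seq 0 (Datatypes.S k)) (fun i => walk i (fun w => p (s ** w)))) / INR (Datatypes.S k)).
  - rewrite E. field. lra.
  - unfold avg.
    replace (fun s => lsum (seq 0 (Datatypes.S k)) (fun i => walk i (fun w => p (s ** w))) / INR (Datatypes.S k))
    with (fun s => / INR (Datatypes.S k) * lsum (seq 0 (Datatypes.S k)) (fun i => walk i (fun w => p (s ** w))) + 0 * 0)
    by (apply functional_extensionality; intro; unfold Rdiv; ring).
    rewrite (lsum_lin S). rewrite (lsum_const S 0). field. pose proof length_pos. lra.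
Qed.

(** An ultrafilter limit of Cesaro averages: the defect of stationarity is divided by the number of
    times and disappears. *)
Lemma stationary_mean : exists C, mean gen C /\
  forall p, bdd p -> C p = avg (fun s => C (fun w => p (s ** w))).
Proof.
  destruct nonprincipal_exists as [U HN]. destruct HN as [HU HT].
  assert (HC : mean gen (fun p => ulim U (fun k => cesaro k p)))
    by (apply mean_ulim; [exact HU|apply mean_cesaro]).
  exists (fun p => ulim U (fun k => cesaro k p)). split; [exact HC|].
  intros p Hp.
  assert (Hl : forall q, bdd q -> islim U (fun i => cesaro i q) (ulim U (fun i => cesaro i q))).
  { intros q [B HB]. apply (ulimP U HU _ B). intro i. now apply (mean_bound (mean_cesaro i)). }
  apply (islim_ulim U HU).
  set (a := avg _).
  assert (H1 : islim U (fun k => avg (fun s => cesaro k (fun w => p (s ** w)))) a).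
  { unfold a, avg.
    apply (islim_ext U HU (fun k => / INR (length S) * lsum S (fun s => cesaro k (fun w => p (s ** w))) + 0 * 0)).
    - apply (ultra_all U HU). intro. unfold Rdiv. ring.
    - replace (lsum S _ / _) with (/ INR (length S) * lsum S (fun s => ulim U (fun k => cesaro k (fun w => p (s ** w)))) + 0 * 0) by (unfold Rdiv; ring).
      apply (islim_lin U HU); [|apply (islim_const U HU)].
      apply islim_lsum; [exact HU|]. intro s. apply Hl. now apply (bdd_comp p (mul s)). }
  (* The numerator is at most [2 * B]; the bound [2 * B + 1] is used because it is positive even
     when [B] is [0]. *)
  assert (H2 : islim U (fun k => (walk (Datatypes.S k) p - walk 0 p) / INR (Datatypes.S k)) 0).
  { destruct Hp as [B HB]. assert (0 <= B) by (eapply Rle_trans; [apply Rabs_pos|apply (HB one)]).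
    intros eps He. destruct (archimed_cor1 (eps / (2 * B + 1))) as [N [HN HN0]].
    { apply Rdiv_lt_0_compat; lra. }
    apply (ultra_mono _ HU _ _ (HT N)). intros k Hk.
    assert (0 < INR N) by now apply lt_0_INR.
    assert (Hk' : INR N < INR (Datatypes.S k)) by (apply lt_INR; lia).
    rewrite Rminus_0_r. unfold Rdiv. rewrite Rabs_mult.
    rewrite (Rabs_right (/ _)) by (apply Rle_ge; left; apply Rinv_0_lt_compat; lra).
    apply Rle_lt_trans with ((2 * B + 1) * / INR N).
    - apply Rmult_le_compat; try apply Rabs_pos.
      + left; apply Rinv_0_lt_compat; lra.
      + pose proof (mean_bound (mean_walk (Datatypes.S k)) p B HB).
        pose proof (mean_bound (mean_walk 0) p B HB).
        unfold Rminus. eapply Rle_trans; [apply Rabs_triang|]. rewrite Rabs_Ropp. lra.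
      + left. now apply Rinv_lt_contravar; [apply Rmult_lt_0_compat; lra|].
    - apply Rmult_lt_compat_l with (r := 2 * B + 1) in HN; [|lra].
      replace ((2 * B + 1) * (eps / (2 * B + 1))) with eps in HN by (field; lra). exact HN. }
  apply (islim_ext U HU (fun k => avg (fun s => cesaro k (fun w => p (s ** w))) -
     (walk (Datatypes.S k) p - walk 0 p) / INR (Datatypes.S k))).
  - apply (ultra_all U HU). intro k. rewrite <- cesaro_shift. ring.
  - replace a with (a - 0) by ring. now apply (islim_minus U HU).
Qed.

(** * Bounded harmonic functions as martingales along the walk *)

Section Harmonic.
Context (h : G -> R) (h1 : forall y, Rabs (h y) <= 1)
  (harm : forall y, h y = avg (fun s => h (y ** s))).

(** Along the walk from [y], [h] is a bounded martingale with mean [h y]; this is its second moment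
    at time [n]. *)
Let energy n y := walk n (fun w => h (y ** w) * h (y ** w)).

#[local] Hint Extern 1 (bdd (fun _ => h _)) => (exists 1; intro; apply h1) : bdd.

Lemma walk_harmonic n y : walk n (fun w => h (y ** w)) = h y.
Proof.
  induction n as [|n IH]; simpl; [now rewrite (grp_one_r _ _ _ HG)|].
  rewrite <- IH. f_equal. apply functional_extensionality. intro w.
  rewrite (harm (y ** w)). f_equal. apply functional_extensionality. intro s.
  now rewrite (grp_assoc _ _ _ HG).
Qed.

(** The mean of [h (y w)] is [h y], so the mean square displacement is the second moment minus the
    square of the mean. *)
Lemma walk_square n y :
  walk n (fun w => (h (y ** w) - h y) * (h (y ** w) - h y)) = energy n y - h y * h y.
Proof.
  unfold energy. pose proof (mean_walk n) as M.
  replace (fun w => (h (y ** w) - h y) * (h (y ** w) - h y)) with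
    (fun w => 1 * (h (y ** w) * h (y ** w)) + (-2 * h y) * (h (y ** w) - h y * / 2))
    by (apply functional_extensionality; intro; field).
  rewrite (mean_lin _ _ M), (mean_minus M), walk_harmonic, (mean_const M) by auto with bdd.
  field.
Qed.

Lemma energy_first n y : energy (Datatypes.S n) y = avg (fun s => energy n (y ** s)).
Proof.
  unfold energy. rewrite walk_first. f_equal. apply functional_extensionality. intro s.
  f_equal. apply functional_extensionality. intro w. now rewrite (grp_assoc _ _ _ HG).
Qed.

Lemma energy_zero y : energy 0 y = h y * h y.
Proof. unfold energy. simpl. now rewrite (grp_one_r _ _ _ HG). Qed.

Lemma energy_one y :
  energy 1 y = h y * h y + avg (fun s => (h (y ** s) - h y) * (h (y ** s) - h y)).
Proof.
  assert (E : walk 1 (fun w => (h (y ** w) - h y) * (h (y ** w) - h y))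
    = avg (fun s => (h (y ** s) - h y) * (h (y ** s) - h y))).
  { simpl. f_equal. apply functional_extensionality. intro s. now rewrite (grp_one_l _ _ _ HG). }
  rewrite walk_square in E. lra.
Qed.

(** From time [0] to time [1] the energy gains a mean of squares; later gains are averages of this
    one over the preceding steps. *)
Lemma energy_grow n y : energy n y <= energy (Datatypes.S n) y.
Proof.
  revert y. induction n as [|n IH]; intro y.
  - rewrite energy_zero, energy_one.
    assert (0 <= avg (fun s => (h (y ** s) - h y) * (h (y ** s) - h y))); [|lra].
    apply (mean_ge0 mean_avg); [auto with bdd|]. intros. apply Rle_0_sqr.
  - rewrite !energy_first.
    assert (B : forall m, bdd (fun s => energy m (y ** s))).
    { intro m. exists 1. intro s. apply (mean_bound (mean_walk m)). intro w.
      rewrite Rabs_mult. rewrite <- (Rmult_1_r 1). apply Rmult_le_compat; auto using Rabs_pos. }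
    apply (mean_mono _ _ mean_avg); auto.
Qed.

Lemma energy_bound n y : Rabs (energy n y) <= 1.
Proof.
  apply (mean_bound (mean_walk n)). intro w.
  rewrite Rabs_mult. rewrite <- (Rmult_1_r 1). apply Rmult_le_compat; auto using Rabs_pos.
Qed.

Lemma energy_cv y : {e | Un_cv (fun n => energy n y) e}.
Proof.
  apply growing_cv.
  - intro n. apply energy_grow.
  - exists 1. intros r [n ->]. eapply Rle_trans; [apply Rle_abs|apply energy_bound].
Qed.

Definition total_energy y := proj1_sig (energy_cv y).
(** The variance of the limit of the martingale that starts at [y]: the amount of movement still to
    come. *)
Definition variance y := total_energy y - h y * h y.

Lemma total_energy_cv y : Un_cv (fun n => energy n y) (total_energy y).
Proof. exact (proj2_sig (energy_cv y)). Qed.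

Lemma energy_le_total n y : energy n y <= total_energy y.
Proof.
  apply (growing_ineq (fun n => energy n y)); [intro; apply energy_grow|apply total_energy_cv].
Qed.

Lemma total_energy_bound y : Rabs (total_energy y) <= 1.
Proof.
  destruct nonprincipal_exists as [U HN].
  apply (islim_bound U (proj1 HN) (fun n => energy n y)); [intro; apply energy_bound|].
  apply islim_cv; [exact HN|apply total_energy_cv].
Qed.

#[local] Hint Extern 1 (bdd (fun _ => total_energy _)) => (exists 1; intro; apply total_energy_bound) : bdd.

Lemma total_energy_harmonic y : total_energy y = avg (fun s => total_energy (y ** s)).
Proof.
  destruct nonprincipal_exists as [U HN]. pose proof (proj1 HN) as HU.
  apply (islim_unique U HU (fun n => energy (Datatypes.S n) y)).
  - apply islim_cv; [exact HN|]. intros eps He.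
    destruct (total_energy_cv y eps He) as [N H]. exists N. intros n Hn. apply H. lia.
  - apply (islim_ext U HU (fun n => / INR (length S) * lsum S (fun s => energy n (y ** s)) + 0 * 0)).
    + apply (ultra_all U HU). intro n. rewrite energy_first. unfold avg, Rdiv. ring.
    + replace (avg _) with (/ INR (length S) * lsum S (fun s => total_energy (y ** s)) + 0 * 0)
        by (unfold avg, Rdiv; ring).
      apply (islim_lin U HU); [|apply (islim_const U HU)].
      apply islim_lsum; [exact HU|]. intro s. apply islim_cv; [exact HN|apply total_energy_cv].
Qed.

Lemma walk_total_energy n y : walk n (fun w => total_energy (y ** w)) = total_energy y.
Proof.
  induction n as [|n IH]; simpl; [now rewrite (grp_one_r _ _ _ HG)|].
  rewrite <- IH. f_equal. apply functional_extensionality. intro w.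
  rewrite (total_energy_harmonic (y ** w)). f_equal. apply functional_extensionality. intro s.
  now rewrite (grp_assoc _ _ _ HG).
Qed.

(** The total energy is harmonic, so the expected variance left after [n] steps is the energy not
    yet spent, which tends to [0]. *)
Lemma walk_variance n y : walk n (fun w => variance (y ** w)) = total_energy y - energy n y.
Proof.
  unfold variance. rewrite (mean_minus (mean_walk n)) by auto with bdd.
  now rewrite walk_total_energy.
Qed.

Lemma variance_ge0 y : 0 <= variance y.
Proof. unfold variance. pose proof (energy_le_total 0 y). rewrite energy_zero in *. lra. Qed.

Lemma bdd_variance y : bdd (fun w => variance (y ** w)).
Proof. unfold variance. auto with bdd. Qed.

(** One step with a nonzero increment already contributes to the energy at time [1], and the energy
    only grows afterwards. *)
Lemma variance_pos y s : In s S -> h (y ** s) <> h y -> 0 < variance y.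
Proof.
  intros Hs Hne.
  assert (0 < avg (fun s => (h (y ** s) - h y) * (h (y ** s) - h y))).
  { apply Rdiv_lt_0_compat; [|apply length_pos].
    apply Rlt_le_trans with ((h (y ** s) - h y) * (h (y ** s) - h y)).
    - apply Rlt_0_sqr. lra.
    - apply (lsum_ge_term S (fun s => (h (y ** s) - h y) * (h (y ** s) - h y))); [|exact Hs].
      intros. apply Rle_0_sqr. }
  unfold variance. pose proof (energy_le_total 1 y). rewrite energy_one in *. lra.
Qed.

(* If no such [w] existed, [(h (x w) - h x)^2] would be bounded pointwise by the losses at the
   points of [ys]; averaging over ever longer walks contradicts the hypothesis on the
   variances. *)
Lemma walk_step x ys (kappa eta eta' : R) (e : R) :
  0 < kappa -> 0 < eta -> 0 < eta' -> e = 1 \/ e = -1 ->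
  8 * kappa + 8 * lsum ys (fun y => variance y / (eta * eta)) < variance x ->
  exists w, gen w /\ 2 * kappa <= e * (h (x ** w) - h x) /\
    (forall y, In y ys -> Rabs (h (y ** w) - h y) <= eta) /\
    (forall y, In y (x :: ys) -> variance (y ** w) <= eta').
Proof.
  intros Hk He He' Hsign Hvar.
  apply NNPP. intro Hno.
  (* Penalties in the style of Chebyshev: all terms are nonnegative, so [loss w <= 1] gives every
     bound required of [w] except the one on the move from [x]. *)
  set (loss := fun w =>
    lsum ys (fun y => (h (y ** w) - h y) * (h (y ** w) - h y) / (eta * eta))
    + lsum (x :: ys) (fun y => variance (y ** w) / eta')).
  assert (Heta : 0 < eta * eta) by now apply Rmult_lt_0_compat.
  assert (L1 : forall w y, 0 <= (h (y ** w) - h y) * (h (y ** w) - h y) / (eta * eta)).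
  { intros. apply Rle_mult_inv_pos; [apply Rle_0_sqr|assumption]. }
  assert (L2 : forall w y, 0 <= variance (y ** w) / eta').
  { intros. apply Rle_mult_inv_pos; [apply variance_ge0|assumption]. }
  assert (nonneg : forall (l : list G) (p : G -> R), (forall y, 0 <= p y) -> 0 <= lsum l p).
  { intros l p Hp. rewrite <- (Rmult_0_r (INR (length l))), <- lsum_const. apply lsum_mono. auto. }
  (* With [u] the signed move, [u * (u + 2)] is at most [8 * kappa] if [u < 2 * kappa], since [u]
     lies between [-2] and [2], and at most [8] if [loss w > 1]. The linear term may be added freely
     because its mean along the walk is [0]. *)
  assert (Hpt : forall w, gen w -> (h (x ** w) - h x) * (h (x ** w) - h x)
      <= 8 * kappa + 8 * loss w - 2 * (e * (h (x ** w) - h x))).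
  { intros w Hw. set (u := e * (h (x ** w) - h x)).
    assert (Eu : (h (x ** w) - h x) * (h (x ** w) - h x) = u * u)
      by (unfold u; destruct Hsign as [-> | ->]; ring).
    rewrite Eu.
    assert (P1 : 0 <= lsum ys (fun y => (h (y ** w) - h y) * (h (y ** w) - h y) / (eta * eta))) by auto.
    assert (P2 : 0 <= lsum (x :: ys) (fun y => variance (y ** w) / eta')) by auto.
    assert (Hloss : 0 <= loss w) by (unfold loss; lra).
    assert (Hu : -2 <= u <= 2).
    { unfold u. pose proof (h1 (x ** w)) as A. pose proof (h1 x) as A'.
      pose proof (Rle_abs (h (x ** w))). pose proof (Rle_abs (- h (x ** w))).
      pose proof (Rle_abs (h x)). pose proof (Rle_abs (- h x)). rewrite !Rabs_Ropp in *.
      destruct Hsign as [-> | ->]; lra. }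
    assert (Hor : u < 2 * kappa \/ 1 < loss w).
    { apply NNPP. intro Hn. apply Hno. exists w. split; [exact Hw|].
      assert (Hu2 : 2 * kappa <= u) by (apply Rnot_lt_le; tauto).
      assert (Hl : loss w <= 1) by (apply Rnot_lt_le; tauto).
      split; [exact Hu2|]. split.
      - intros y Hy.
        pose proof (lsum_ge_term ys _ y (fun y _ => L1 w y) Hy) as Q. simpl in Q.
        apply Rsqr_incr_0; [|apply Rabs_pos|lra]. rewrite <- Rsqr_abs. unfold Rsqr.
        apply Rmult_le_reg_r with (/ (eta * eta)); [now apply Rinv_0_lt_compat|].
        replace (eta * eta * / (eta * eta)) with 1 by (field; lra).
        unfold loss in Hl. unfold Rdiv in *. lra.
      - intros y Hy.
        pose proof (lsum_ge_term (x :: ys) _ y (fun y _ => L2 w y) Hy) as Q. simpl in Q.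
        apply Rmult_le_reg_r with (/ eta'); [now apply Rinv_0_lt_compat|].
        replace (eta' * / eta') with 1 by (field; lra).
        unfold loss in Hl. unfold Rdiv in *. simpl in *. lra. }
    destruct Hor; nra. }
  assert (Hint : forall n, energy n x - h x * h x <= 8 * kappa +
     8 * (lsum ys (fun y => (energy n y - h y * h y) / (eta * eta))
     + lsum (x :: ys) (fun y => (total_energy y - energy n y) / eta'))).
  { intro n. rewrite <- walk_square. pose proof (mean_walk n) as M.
    assert (B1 : forall y, bdd (fun w => (h (y ** w) - h y) * (h (y ** w) - h y) / (eta * eta)))
      by auto with bdd.
    assert (B2 : forall y, bdd (fun w => variance (y ** w) / eta')).
    { intro y. apply bdd_div, bdd_variance. }
    assert (B3 : bdd loss).
    { unfold loss. apply bdd_plus; apply (bdd_lsum _ (fun y w => _)); auto. }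
    eapply Rle_trans.
    { refine (mean_mono _ _ M (fun w => (h (x ** w) - h x) * (h (x ** w) - h x))
        (fun w => 8 * kappa + 8 * loss w - 2 * (e * (h (x ** w) - h x))) _ _ Hpt); auto with bdd. }
    rewrite (mean_minus M), (mean_plus M), (mean_const M), (mean_scal M) by auto with bdd.
    rewrite (mean_scal M 2), (mean_scal M e), (mean_minus M), walk_harmonic, (mean_const M) by auto with bdd.
    unfold loss. rewrite (mean_plus M) by (apply (bdd_lsum _ (fun y w => _)); auto).
    rewrite (mean_lsum M ys (fun y w => (h (y ** w) - h y) * (h (y ** w) - h y) / (eta * eta))) by auto.
    rewrite (mean_lsum M (x :: ys) (fun y w => variance (y ** w) / eta')) by auto.
    replace (fun y => walk n (fun w => (h (y ** w) - h y) * (h (y ** w) - h y) / (eta * eta))) with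
      (fun y => (energy n y - h y * h y) / (eta * eta)).
    2:{ apply functional_extensionality. intro y. rewrite <- walk_square. symmetry.
        apply (mean_div M). auto with bdd. }
    replace (fun y => walk n (fun w => variance (y ** w) / eta')) with
      (fun y => (total_energy y - energy n y) / eta').
    2:{ apply functional_extensionality. intro y. rewrite <- walk_variance. symmetry.
        apply (mean_div M), bdd_variance. }
    lra. }
  destruct nonprincipal_exists as [U HN]. pose proof (proj1 HN) as HU.
  assert (Hen : forall y, islim U (fun n => energy n y) (total_energy y))
    by (intro; apply islim_cv; [exact HN|apply total_energy_cv]).
  assert (Hdiv : forall p c d, islim U p c -> islim U (fun n => p n / d) (c / d)).
  { intros p c d Hp. apply (islim_ext U HU (fun n => / d * p n + 0 * 0)).
    - apply (ultra_all U HU). intro. unfold Rdiv. ring.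
    - replace (c / d) with (/ d * c + 0 * 0) by (unfold Rdiv; ring).
      apply (islim_lin U HU); [exact Hp|apply (islim_const U HU)]. }
  (* As the time grows, the terms with [eta'] vanish; this is why [eta'] can be prescribed
     arbitrarily small. *)
  assert (Hlim : variance x <= 8 * kappa + 8 * (1 * lsum ys (fun y => variance y / (eta * eta))
     + 1 * lsum (x :: ys) (fun y => (total_energy y - total_energy y) / eta'))).
  { apply (islim_le U HU (fun n => energy n x - h x * h x)
      (fun n => 1 * (8 * kappa) +
     8 * (1 * lsum ys (fun y => (energy n y - h y * h y) / (eta * eta))
     + 1 * lsum (x :: ys) (fun y => (total_energy y - energy n y) / eta')))).
    - apply (ultra_all U HU). intro n. specialize (Hint n). lra.
    - apply (islim_minus U HU); [apply Hen|apply (islim_const U HU)].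
    - replace (8 * kappa + _) with (1 * (8 * kappa) + 8 * (1 * lsum ys (fun y => variance y / (eta * eta))
     + 1 * lsum (x :: ys) (fun y => (total_energy y - total_energy y) / eta'))) by ring.
      apply (islim_lin U HU); [apply (islim_const U HU)|].
      apply (islim_lin U HU); apply (islim_lsum U _ (fun y n => _)); auto; intro y; apply Hdiv;
        apply (islim_minus U HU); auto; apply (islim_const U HU). }
  replace (fun y => (total_energy y - total_energy y) / eta') with (fun _ : G => 0) in Hlim
    by (apply functional_extensionality; intro; unfold Rdiv; ring).
  rewrite lsum_const in Hlim. lra.
Qed.

End Harmonic.
End Walk.

(** * Harmonic functions with the double limit property *)

Definition ind {X : Type} (A : X -> Prop) (x : X) : R :=
  if excluded_middle_informative (A x) then 1 else 0.

Lemma ind_cases {X : Type} (A : X -> Prop) x : (A x /\ ind A x = 1) \/ (~ A x /\ ind A x = 0).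
Proof. unfold ind. destruct (excluded_middle_informative (A x)); auto. Qed.

Lemma ind_01 {X : Type} (A : X -> Prop) x : 0 <= ind A x <= 1.
Proof. destruct (ind_cases A x) as [[_ ->]|[_ ->]]; lra. Qed.

Lemma bdd_01 {X : Type} (p : X -> R) : (forall x, 0 <= p x <= 1) -> bdd p.
Proof. intro H. exists 1. intro x. specialize (H x). apply Rabs_le. lra. Qed.

Lemma bdd_ind {X : Type} (A : X -> Prop) : bdd (ind A).
Proof. apply bdd_01, ind_01. Qed.
#[local] Hint Resolve bdd_ind : bdd.

(** * Sets of large mean: a subsequence with the finite intersection property *)

Section FIP.
Context {X : Type} {Z : X -> Prop} {C : (X -> R) -> R} (HC : mean Z C)
  (A : nat -> X -> Prop) (U : (nat -> Prop) -> Prop) (HN : nonprincipal U).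

Let HU : ultra U := proj1 HN.
(** The mass that [p] shares with [A k] in the limit. As long as it is positive, the intersection
    represented by [p] can be continued with further sets. *)
Let rest (p : X -> R) : R := ulim U (fun k => C (fun x => p x * ind (A k) x)).

Lemma rest_lim p : bdd p -> islim U (fun k => C (fun x => p x * ind (A k) x)) (rest p).
Proof.
  intros [B HB]. apply (ulimP U HU _ B). intro k. apply (mean_bound HC). intro x.
  rewrite Rabs_mult. rewrite <- (Rmult_1_r B).
  apply Rmult_le_compat; auto using Rabs_pos.
  pose proof (ind_01 (A k) x). apply Rabs_le. lra.
Qed.

Lemma rest_step p N :
  (forall x, 0 <= p x <= 1) -> 0 < rest p ->
  exists i, (N <= i)%nat /\ 0 < rest (fun x => ind (A i) x * p x).
Proof.
  intros Hp Hpos. set (eta := rest p) in *.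
  assert (Bp : bdd p) by now apply bdd_01.
  apply NNPP. intro Hno.
  assert (H0 : forall i, (N <= i)%nat -> rest (fun x => ind (A i) x * p x) <= 0).
  { intros i Hi. apply Rnot_lt_le. intro Hlt. apply Hno. now exists i. }
  (* [u] is the indicator of a union of sets [A i], almost disjoint inside [p]; its mean cannot
     grow forever. *)
  assert (Hgrow : forall n, exists u, (forall x, 0 <= u x <= 1) /\
    rest (fun x => p x * u x) <= 0 /\ INR n * (eta / 2) <= C (fun x => p x * u x)).
  { induction n as [|n (u & Hu & Hru & HCu)].
    - exists (fun _ => 0). split; [intro; lra|].
      replace (fun x => p x * 0) with (fun _ : X => 0) by (apply functional_extensionality; intro; ring).
      split; [|simpl; rewrite (mean_const HC); lra].
      unfold rest. right. apply (islim_ulim U HU).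
      apply (islim_ext U HU (fun _ => 0)); [|apply (islim_const U HU)].
      apply (ultra_all U HU). intro k.
      replace (fun x => 0 * ind (A k) x) with (fun _ : X => 0) by (apply functional_extensionality; intro; ring).
      now rewrite (mean_const HC).
    - assert (Bu : bdd u) by now apply bdd_01.
      (* For this [i] the set [A i] carries more than [3 / 4 * eta] of the mass of [p], and less
         than [eta / 4] of it lies in [u]; adding [A i] to [u] therefore gains more than
         [eta / 2]. *)
      destruct (ultra_ne _ HU _ (ultra_and _ HU _ _ (proj2 HN N)
        (ultra_and _ HU _ _ (rest_lim p Bp (eta / 4) ltac:(lra))
          (rest_lim (fun x => p x * u x) ltac:(auto with bdd) (eta / 4) ltac:(lra))))) as [i (Hi & h1 & h2)].
      apply Rabs_def2 in h1. apply Rabs_def2 in h2. fold eta in h1.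
      exists (fun x => u x + ind (A i) x - u x * ind (A i) x). split; [|split].
      + intro x. specialize (Hu x). pose proof (ind_01 (A i) x). nra.
      +
        specialize (H0 i Hi).
        assert (rest (fun x => p x * (u x + ind (A i) x - u x * ind (A i) x)) <=
           1 * rest (fun x => p x * u x) + 1 * rest (fun x => ind (A i) x * p x)); [|lra].
        apply (islim_le U HU (fun k => C (fun x => p x * (u x + ind (A i) x - u x * ind (A i) x) * ind (A k) x))
         (fun k => 1 * C (fun x => p x * u x * ind (A k) x) + 1 * C (fun x => ind (A i) x * p x * ind (A k) x))).
        * apply (ultra_all U HU). intro k.
          rewrite !Rmult_1_l, <- (mean_plus HC) by auto with bdd.
          apply (mean_mono _ _ HC); [auto 6 with bdd..|]. intros x _.
          specialize (Hp x). specialize (Hu x). pose proof (ind_01 (A i) x). pose proof (ind_01 (A k) x).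
          assert (0 <= p x * u x) by nra.
          assert (0 <= p x * u x * ind (A i) x) by nra.
          assert (0 <= p x * u x * ind (A i) x * ind (A k) x) by nra. nra.
        * apply rest_lim. auto 6 with bdd.
        * apply (islim_lin U HU); apply rest_lim; auto with bdd.
      + replace (fun x => p x * (u x + ind (A i) x - u x * ind (A i) x)) with
          (fun x => p x * u x + p x * ind (A i) x - p x * u x * ind (A i) x)
          by (apply functional_extensionality; intro; ring).
        rewrite (mean_minus HC), (mean_plus HC) by auto with bdd. rewrite S_INR. lra. }
  destruct (INR_unbounded (2 / eta)) as [n Hn].
  destruct (Hgrow n) as (u & Hu & _ & HCu).
  assert (C (fun x => p x * u x) <= 1).
  { rewrite <- (mean_one _ _ HC). assert (bdd u) by now apply bdd_01.
    apply (mean_mono _ _ HC); auto with bdd. intros x _. specialize (Hp x). specialize (Hu x). nra. }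
  assert (INR n * (eta / 2) > 1); [|lra].
  apply Rmult_lt_compat_r with (r := eta / 2) in Hn; [|lra].
  replace (2 / eta * (eta / 2)) with 1 in Hn by (field; lra). lra.
Qed.

(** Sets are intersected one at a time while [rest] stays positive. An intersection that missed [Z]
    would have [rest] at most [0], because the mean is carried by [Z]. The condition [t <= i t]
    makes the indices tend to infinity. *)
Lemma mean_fip delta :
  0 < delta -> (forall m, delta <= C (ind (A m))) ->
  exists i : nat -> nat, (forall t, (t <= i t)%nat) /\
    forall n, exists x, Z x /\ forall t, (t < n)%nat -> A (i t) x.
Proof.
  intros Hd HA.
  set (inter := fix inter (l : list nat) (x : X) : R :=
    match l with [] => 1 | i :: l => ind (A i) x * inter l x end).
  assert (H01 : forall l x, 0 <= inter l x <= 1).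
  { induction l as [|i l IH]; intro x; simpl; [lra|].
    specialize (IH x). pose proof (ind_01 (A i) x). nra. }
  destruct (history_choice (fun l => 0 < rest (inter l) /\
      match l with [] => True | i :: l => (length l <= i)%nat end)) as [i Hi].
  - split; [|exact Logic.I]. apply Rlt_le_trans with delta; [exact Hd|].
    apply (islim_le U HU (fun _ => delta) (fun k => C (fun x => inter [] x * ind (A k) x))).
    + apply (ultra_all U HU). intro k.
      replace (fun x => inter [] x * ind (A k) x) with (ind (A k)); [apply HA|].
      apply functional_extensionality. intro. simpl. ring.
    + apply (islim_const U HU).
    + apply rest_lim. apply bdd_01, H01.
  - intros l [Hl _]. destruct (rest_step (inter l) (length l) (H01 l) Hl) as [i [h1 h2]].
    exists i. auto.
  - exists i. split.
    + intro t. destruct (Hi (S t)) as [_ h]. simpl in h. now rewrite hist_length in h.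
    + intro n. destruct (Hi n) as [h _]. apply NNPP. intro Hno.
      assert (rest (inter (hist i n)) <= 0); [|lra].
      apply (islim_le U HU (fun k => C (fun x => inter (hist i n) x * ind (A k) x)) (fun _ => 0)).
      * apply (ultra_all U HU). intro k. rewrite <- (mean_const HC 0).
        assert (bdd (inter (hist i n))) by apply bdd_01, H01.
        apply (mean_mono _ _ HC); [auto with bdd..|]. intros x Hx.
        assert (E : inter (hist i n) x = 0).
        { destruct (H01 (hist i n) x) as [[hlt|heq] _]; [|auto].
          exfalso. apply Hno. exists x. split; [exact Hx|].
          assert (G : forall l, 0 < inter l x -> forall t, In t l -> A t x).
          { induction l as [|a l IH]; simpl; [easy|]. intros Hpos t.
            destruct (ind_cases (A a) x) as [[Ha Ea]|[_ Ea]]; rewrite Ea in Hpos; [|lra].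
            intros [<-|Ht]; [exact Ha|]. apply IH; [lra|exact Ht]. }
          intros t Ht. apply (G _ hlt). apply in_hist. now exists t. }
        rewrite E. lra.
      * apply rest_lim. apply bdd_01, H01.
      * apply (islim_const U HU).
Qed.

End FIP.

Lemma double_limit_comp {X Y X' Y' : Type} (F : X -> Y -> R) (a : X' -> X) (b : Y' -> Y) :
  double_limit F -> double_limit (fun x y => F (a x) (b y)).
Proof. intros H u v. exact (H (fun i => a (u i)) (fun j => b (v j))). Qed.

(** Distributes the indices over the levels so that each level receives infinitely many of them. *)
Definition level (n : nat) : nat := fst (Cantor.of_nat n).

Lemma level_infinite m N : exists n, (N <= n)%nat /\ level n = m.
Proof.
  exists (Cantor.to_nat (m, N)). split.
  - pose proof (Cantor.to_nat_non_decreasing m N). lia.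
  - unfold level. now rewrite Cantor.cancel_of_to.
Qed.

(* Reversing the last colour seen among close elements of the same level forces, at every
   level, a close pair of opposite colours. *)
Section Colouring.
Context {X : Type} (close : nat -> X -> X -> Prop).

(** With the newest entry first, the length of the tail is the index of the head. The value [true]
    is the default when no earlier entry of level [m] is close to [b]. *)
Fixpoint opposite (m : nat) (l : list (X * bool)) (b : X) : bool :=
  match l with
  | [] => true
  | (b', c) :: l =>
      if excluded_middle_informative (level (length l) = m /\ close m b b')
      then negb c else opposite m l b
  end.

Definition colour (l : list (X * bool)) (b : X) : bool := opposite (level (length l)) l b.

Context (close_sym : forall m a b, close m a b -> close m b a)
  (b : nat -> X) (c : nat -> bool)
  (Hc : forall n, c n = colour (hist (fun i => (b i, c i)) n) (b n)).

Lemma opposite_hist m x n k :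
  (k < n)%nat -> level k = m -> close m x (b k) ->
  exists k', close m x (b k') /\ opposite m (hist (fun i => (b i, c i)) n) x = negb (c k').
Proof.
  induction n as [|n IH]; intros Hk Hl Hcl; [lia|]. simpl. rewrite hist_length.
  destruct (excluded_middle_informative (level n = m /\ close m x (b n))) as [[_ h]|h].
  - now exists n.
  - apply IH; auto. destruct (Nat.eq_dec k n) as [->|]; [|lia]. exfalso. auto.
Qed.

(** The partner of [i] need not be [k]: the colour of [i] reverses that of the latest close
    predecessor of its level, and [k] only ensures that there is one. *)
Lemma both_colours m i k :
  (k < i)%nat -> level i = m -> level k = m -> close m (b i) (b k) ->
  exists r p, c r = true /\ c p = false /\ close m (b r) (b p).
Proof.
  intros Hki Hi Hk Hcl.
  destruct (opposite_hist m (b i) i k Hki Hk Hcl) as [k' [h1 h2]].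
  assert (E : c i = negb (c k')).
  { rewrite Hc. unfold colour. now rewrite hist_length, Hi. }
  destruct (c k') eqn:Ek; simpl in E.
  - exists k', i. auto.
  - exists i, k'. auto.
Qed.

End Colouring.

(** * A Liouville theorem: [h] is constant along the walk *)

Section Liouville.
Context {G : Type} {mul : G -> G -> G} {one : G} {inv : G -> G}
  (HG : group_laws mul one inv) (S : list G) (HS : S <> [])
  (f : G -> R) (f1 : forall g, Rabs (f g) <= 1)
  (Hf : double_limit (fun x y => f (mul x y)))
  (C : (G -> R) -> R) (HC : mean (gen (mul := mul) (one := one) S) C)
  (Cinv : forall p, bdd p -> C p = avg S (fun s => C (fun w => p (mul s w)))).
Local Notation "x ** y" := (mul x y) (at level 40, left associativity).
Local Notation gen := (gen (mul := mul) (one := one) S).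

Lemma bdd_f (k : G -> G) : bdd (fun g => f (k g)).
Proof. exists 1. auto. Qed.
#[local] Hint Resolve bdd_f : bdd.

Let h y := C (fun w => f (y ** w)).

Lemma h_bound y : Rabs (h y) <= 1.
Proof. apply (mean_bound HC). auto. Qed.

Lemma h_harmonic y : h y = avg S (fun s => h (y ** s)).
Proof.
  unfold h. rewrite Cinv by auto with bdd. f_equal. apply functional_extensionality. intro s.
  f_equal. apply functional_extensionality. intro w. now rewrite (grp_assoc _ _ _ HG).
Qed.

(** The products of at most [m] elements of [S]: finite sets that exhaust the semigroup. *)
Fixpoint ball (m : nat) : list G :=
  match m with
  | O => [one]
  | Datatypes.S m => ball m ++ flat_map (fun g => map (mul g) S) (ball m)
  end.

Lemma ball_exhausts g : gen g -> exists m0, forall m, (m0 <= m)%nat -> In g (ball m).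
Proof.
  assert (mono : forall g m m', (m <= m')%nat -> In g (ball m) -> In g (ball m')).
  { intros x m m' Hm Hx. induction Hm; [exact Hx|]. simpl. apply in_or_app. now left. }
  intro Hg. assert (exists m0, In g (ball m0)) as [m0 H].
  { induction Hg as [|g s Hg [m IH] Hs].
    - exists 0%nat. now left.
    - exists (Datatypes.S m). simpl. apply in_or_app. right. apply in_flat_map.
      exists g. split; [exact IH|]. now apply in_map. }
  exists m0. intros m Hm. now apply (mono g m0).
Qed.

Context (x : G).

(** Basic entourages, indexed by [m], for pointwise convergence on the semigroup of the functions
    that send [g] to [f (x b^-1 g)]. *)
Definition closeby (m : nat) (b b' : G) : Prop :=
  forall g, In g (ball m) -> Rabs (f (x ** inv b ** g) - f (x ** inv b' ** g)) < / (INR m + 1).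

Lemma closeby_sym m b b' : closeby m b b' -> closeby m b' b.
Proof. intros H g Hg. rewrite Rabs_minus_sym. auto. Qed.

(** Compactness: along an ultrafilter containing the indices of level [m], the bounded values at the
    finitely many points of the ball converge, so two such indices have all their values within half
    the tolerance of the limits. *)
Lemma closeby_recurs (b : nat -> G) m :
  exists i k, (k < i)%nat /\ level i = m /\ level k = m /\ closeby m (b i) (b k).
Proof.
  destruct (nonprincipal_containing (fun n => level n = m) (level_infinite m)) as [U [[HU HT] HP]].
  assert (Hd : 0 < / (INR m + 1) / 2) by (pose proof (inv_INR_pos m); lra).
  set (L := fun g => ulim U (fun i => f (x ** inv (b i) ** g))).
  assert (HA : U (fun i => level i = m /\
     forall g, In g (ball m) -> Rabs (f (x ** inv (b i) ** g) - L g) < / (INR m + 1) / 2)).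
  { apply (ultra_and _ HU _ _ HP).
    apply (ultra_list U HU _ (fun g i => Rabs (f (x ** inv (b i) ** g) - L g) < / (INR m + 1) / 2)).
    intros g _. apply (ulimP U HU _ 1); auto. }
  destruct (ultra_ne _ HU _ HA) as [k [Hk1 Hk2]].
  destruct (ultra_ne _ HU _ (ultra_and _ HU _ _ HA (HT (Datatypes.S k)))) as [i [[Hi1 Hi2] Hki]].
  exists i, k. repeat split; auto. intros g Hg.
  specialize (Hk2 g Hg). specialize (Hi2 g Hg).
  apply Rabs_def2 in Hk2. apply Rabs_def2 in Hi2. apply Rabs_def1; lra.
Qed.

Let V := variance HG S HS h h_bound h_harmonic.
Let sgn (c : bool) : R := if c then 1 else -1.

(** Each earlier index [i] follows its own martingale, started at [x] when [b i] is the current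
    point. The next step moves the newest one in the direction of its colour and nearly freezes the
    older ones, whose variances have been made tiny. *)
Lemma coloured_walk : 0 < V x ->
  exists kappa (b : nat -> G) (c : nat -> bool), 0 < kappa /\
    (forall n, gen (b n)) /\
    (forall n, c n = colour closeby (hist (fun i => (b i, c i)) n) (b n)) /\
    (forall i n, (i < n)%nat -> kappa <= sgn (c i) * (h (x ** inv (b i) ** b n) - h x)).
Proof.
  (* The hypothesis of [walk_step] is met with room to spare: [8 * kappa] is a quarter of [V x], and
     [v] is chosen so that the older martingales together cost at most half of [V x]. *)
  intro HV. set (kappa := V x / 32). assert (Hk : 0 < kappa) by (unfold kappa; lra).
  (* The margin [kappa * (1 + (/ 2) ^ n)] decreases by exactly [eta n] from [n] to [n + 1] and stays
     above [kappa]. *)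
  set (eta := fun n : nat => kappa * (/ 2) ^ (n + 1)).
  set (v := fun n => V x * (eta n * eta n) / (16 * (INR n + 1))).
  assert (Heta : forall n, 0 < eta n).
  { intro n. apply Rmult_lt_0_compat; [exact Hk|]. apply pow_lt. lra. }
  assert (Hv : forall n, 0 < v n).
  { intro n. pose proof (pos_INR n). pose proof (Heta n). apply Rdiv_lt_0_compat; [|lra].
    apply Rmult_lt_0_compat; [exact HV|now apply Rmult_lt_0_compat]. }
  set (Inv := fun l : list (G * bool) => match l with [] => True | (b, c) :: l =>
    gen b /\ c = colour closeby l b /\
    forall q, In q l ->
      kappa * (1 + (/ 2) ^ length l) <= sgn (snd q) * (h (x ** inv (fst q) ** b) - h x) /\
      V (x ** inv (fst q) ** b) <= v (length l) end).
  destruct (history_choice Inv) as [s Hs].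
  - exact Logic.I.
  - intros [|[b c] l] Hinv.
    + exists (one, colour closeby [] one). simpl. split; [constructor|split; [reflexivity|easy]].
    + destruct Hinv as (Hb & Hcol & Hl).
      set (n := length l) in *. set (ys := map (fun q => x ** inv (fst q) ** b) l).
      destruct (walk_step HG S HS h h_bound h_harmonic x ys kappa (eta n) (v (Datatypes.S n)) (sgn c))
        as (w & Hw & Hmove & Hstay & Hvar); auto.
      { unfold sgn. destruct c; auto. }
      { fold V. apply Rle_lt_trans with (8 * kappa + 8 * (INR (length ys) * (v n / (eta n * eta n)))).
        - apply Rplus_le_compat_l, Rmult_le_compat_l; [lra|]. rewrite <- lsum_const.
          apply lsum_mono. intros y Hy. apply in_map_iff in Hy. destruct Hy as [q [<- Hq]].
          apply Rmult_le_compat_r; [|now apply Hl].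
          left. apply Rinv_0_lt_compat. now apply Rmult_lt_0_compat.
        - unfold ys. rewrite length_map. fold n. unfold v.
          pose proof (pos_INR n). pose proof (Heta n).
          replace (INR n * _) with (V x / 16 * (INR n / (INR n + 1))) by (field; split; lra).
          assert (INR n / (INR n + 1) <= 1).
          { apply Rmult_le_reg_r with (INR n + 1); [lra|]. unfold Rdiv.
            rewrite Rmult_assoc, Rinv_l; lra. }
          unfold kappa. nra. }
      exists (b ** w, colour closeby ((b, c) :: l) (b ** w)).
      assert (Hhalf : (/ 2) ^ (Datatypes.S n) <= 1).
      { rewrite <- (pow1 (Datatypes.S n)). apply pow_incr. lra. }
      cbn [length]. fold n.
      split; [now apply (gen_mul HG)|]. split; [reflexivity|].
      intros q [<-|Hq]; cbn [fst snd length]; fold n.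
      (* For the newest point, [x b^-1 (b w)] is [x w], so its martingale starts at [x] and gains
         the full [2 * kappa]. *)
      * rewrite <- (grp_assoc _ _ _ HG (x ** inv b)), (grp_assoc _ _ _ HG x), (grp_inv_l _ _ _ HG), (grp_one_r _ _ _ HG).
        split; [|apply Hvar; now left].
        eapply Rle_trans; [|exact Hmove]. nra.
      * rewrite <- (grp_assoc _ _ _ HG (x ** inv (fst q))).
        assert (Hin : In (x ** inv (fst q) ** b) ys) by (now apply (in_map (fun q => x ** inv (fst q) ** b))).
        split; [|apply Hvar; now right].
        destruct (Hl q Hq) as [h1 _]. specialize (Hstay _ Hin).
        pose proof (Rle_abs (h (x ** inv (fst q) ** b ** w) - h (x ** inv (fst q) ** b))).
        pose proof (Rle_abs (- (h (x ** inv (fst q) ** b ** w) - h (x ** inv (fst q) ** b)))).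
        rewrite Rabs_Ropp in *.
        assert (E : kappa * (1 + (/ 2) ^ Datatypes.S n) = kappa * (1 + (/ 2) ^ n) - eta n).
        { unfold eta. rewrite Nat.add_1_r. simpl. field. }
        rewrite E. unfold sgn in *. destruct (snd q); lra.
  - exists kappa, (fun n => fst (s n)), (fun n => snd (s n)). split; [exact Hk|].
    assert (E : (fun i => (fst (s i), snd (s i))) = s)
      by (apply functional_extensionality; intro i; now destruct (s i)).
    rewrite E.
    assert (Hn : forall n, Inv (s n :: hist s n)) by (intro n; exact (Hs (Datatypes.S n))).
    split; [|split]; [intro n|intro n|intros i n Hin]; specialize (Hn n);
      destruct (s n) as [b c]; destruct Hn as (h1 & h2 & h3); auto.
    destruct (h3 (s i)) as [h4 _]; [apply in_hist; now exists i|].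
    eapply Rle_trans; [|exact h4]. assert (0 < (/ 2) ^ length (hist s n)) by (apply pow_lt; lra). nra.
Qed.

(** The differences [Delta m] of the translates attached to pairs of opposite colours tend to [0] at
    each point of the semigroup, yet their integrals stay above [2 * kappa]; the two orders of
    limits then disagree by at least [kappa]. *)
Lemma variance_zero : V x <= 0.
Proof.
  apply Rnot_lt_le. intro HV.
  destruct (coloured_walk HV) as (kappa & b & c & Hk & Hgen & Hcol & Hcommit).
  assert (Hpair : forall m, exists rp : nat * nat, c (fst rp) = true /\ c (snd rp) = false /\
     closeby m (b (fst rp)) (b (snd rp))).
  { intro m. destruct (closeby_recurs b m) as (i & k & h1 & h2 & h3 & h4).
    destruct (both_colours closeby closeby_sym b c Hcol m i k h1 h2 h3 h4) as (r & p & H).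
    now exists (r, p). }
  set (rp := fun m => proj1_sig (constructive_indefinite_description _ (Hpair m))).
  assert (Hrp : forall m, c (fst (rp m)) = true /\ c (snd (rp m)) = false /\
     closeby m (b (fst (rp m))) (b (snd (rp m))))
    by (intro m; exact (proj2_sig (constructive_indefinite_description _ (Hpair m)))).
  clearbody rp.
  set (ar := fun m => x ** inv (b (fst (rp m)))). set (ap := fun m => x ** inv (b (snd (rp m)))).
  destruct nonprincipal_exists as [U HN]. pose proof (proj1 HN) as HU.
  (* The limit of the translates of [C] by the points [b j]; it is carried by the semigroup because
     every [b j] belongs to it. *)
  set (beta := fun p : G -> R => ulim U (fun j => C (fun w => p (b j ** w)))).
  assert (Hbeta : mean gen beta).
  { apply mean_ulim; [exact HU|]. intro j. constructor.
    - intros s t p q Hp Hq. apply (mean_lin _ _ HC s t (fun w => p (b j ** w)) (fun w => q (b j ** w)));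
        now apply (bdd_comp _ (mul (b j))).
    - intros p q Hp Hq H. apply (mean_mono _ _ HC); try now apply (bdd_comp _ (mul (b j))).
      intros w Hw. apply H. now apply (gen_mul HG).
    - apply (mean_one _ _ HC). }
  set (Delta := fun m g => f (ar m ** g) - f (ap m ** g)).
  (* Once [j] exceeds both indices of the pair, the colours place [h (ar m ** b j)] at least [kappa]
     above [h x] and [h (ap m ** b j)] at least [kappa] below it. *)
  assert (HD : forall m, 2 * kappa <= beta (Delta m)).
  { intro m. destruct (Hrp m) as (hr & hp & _).
    apply (islim_le U HU (fun _ => 2 * kappa) (fun j => C (fun w => Delta m (b j ** w)))).
    - apply (ultra_mono _ HU _ _ (proj2 HN (Nat.max (Datatypes.S (fst (rp m))) (Datatypes.S (snd (rp m)))))).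
      intros j Hj.
      assert (E : C (fun w => Delta m (b j ** w)) = h (ar m ** b j) - h (ap m ** b j)).
      { unfold Delta. rewrite (mean_minus HC) by auto with bdd. unfold h. f_equal; f_equal;
        apply functional_extensionality; intro w; now rewrite (grp_assoc _ _ _ HG). }
      rewrite E. pose proof (Hcommit (fst (rp m)) j ltac:(lia)) as q1.
      pose proof (Hcommit (snd (rp m)) j ltac:(lia)) as q2.
      rewrite hr in q1. rewrite hp in q2. unfold sgn in *. unfold ar, ap. lra.
    - apply (islim_const U HU).
    - apply (ulimP U HU _ 2). intro j. apply (mean_bound HC). intro w. unfold Delta.
      unfold Rminus. eapply Rle_trans; [apply Rabs_triang|]. rewrite Rabs_Ropp.
      pose proof (f1 (ar m ** (b j ** w))). pose proof (f1 (ap m ** (b j ** w))). lra. }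
  destruct (mean_fip Hbeta (fun m g => kappa <= Delta m g) U HN (kappa / 2)) as (i & Hi & Hg); [lra| |].
  { intro m. specialize (HD m).
    (* Markov's inequality: [Delta m] is at most [2], so a mean of at least [2 * kappa] forces the
       set where it reaches [kappa] to have mean at least [kappa / 2]. *)
    assert (beta (Delta m) <= beta (fun g => kappa + 2 * ind (fun g => kappa <= Delta m g) g)).
    { apply (mean_mono _ _ Hbeta); [unfold Delta; auto with bdd|auto with bdd|]. intros g _.
      destruct (ind_cases (fun g => kappa <= Delta m g) g) as [[H ->]|[H ->]]; [|lra].
      unfold Delta. pose proof (f1 (ar m ** g)) as A1. pose proof (f1 (ap m ** g)) as A2.
      apply Rabs_le_bounds in A1. apply Rabs_le_bounds in A2. lra. }
    rewrite (mean_plus Hbeta), (mean_const Hbeta), (mean_scal Hbeta) in H by auto with bdd.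
    lra. }
  assert (exists g : nat -> G, forall n, gen (g n) /\ forall t, (t < n)%nat -> kappa <= Delta (i t) (g n)) as [g Hg'].
  { exists (fun n => proj1_sig (constructive_indefinite_description _ (Hg n))).
    intro n. exact (proj2_sig (constructive_indefinite_description _ (Hg n))). }
  assert (Hswap : forall a : nat -> G,
     ulim U (fun t => ulim U (fun n => f (a (i t) ** g n))) =
     ulim U (fun n => ulim U (fun t => f (a (i t) ** g n)))).
  { intro a. apply (double_limit_ultra (fun t n => f (a (i t) ** g n)) U U
      (fun t => ulim U (fun n => f (a (i t) ** g n))) (fun n => ulim U (fun t => f (a (i t) ** g n)))); auto.
    - exact (double_limit_comp (fun x y => f (x ** y)) (fun t => a (i t)) g Hf).
    - intro t. apply (ulimP U HU _ 1). auto.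
    - apply (ulimP U HU _ 1). intro t. apply (ulim_bound U HU). auto.
    - intro t. apply (ulimP U HU _ 1). auto.
    - apply (ulimP U HU _ 1). intro t. apply (ulim_bound U HU). auto. }
  (* Limit in [n] first: for fixed [t], every [g n] with [n > t] keeps the difference at least
     [kappa]. *)
  assert (Hlow : kappa <= ulim U (fun t => ulim U (fun n => f (ar (i t) ** g n))) -
     ulim U (fun t => ulim U (fun n => f (ap (i t) ** g n)))).
  { apply (islim_le U HU (fun _ => kappa) (fun t => ulim U (fun n => f (ar (i t) ** g n)) - ulim U (fun n => f (ap (i t) ** g n)))).
    - apply (ultra_all U HU). intro t.
      apply (islim_le U HU (fun _ => kappa) (fun n => f (ar (i t) ** g n) - f (ap (i t) ** g n))).
      + apply (ultra_mono _ HU _ _ (proj2 HN (Datatypes.S t))). intros n Hn. apply Hg'. lia.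
      + apply (islim_const U HU).
      + apply (islim_minus U HU); apply (ulimP U HU _ 1); auto.
    - apply (islim_const U HU).
    - apply (islim_minus U HU); apply (ulimP U HU _ 1); intro t; apply (ulim_bound U HU); auto. }
  (* Limit in [t] first: the fixed point [g n] lies in all large balls, and [i t >= t] makes the
     tolerance of closeness there tend to [0]. *)
  assert (Hzero : (fun n => ulim U (fun t => f (ar (i t) ** g n))) = (fun n => ulim U (fun t => f (ap (i t) ** g n)))).
  { apply functional_extensionality. intro n. apply Rminus_diag_uniq.
    apply (islim_unique U HU (fun t => f (ar (i t) ** g n) - f (ap (i t) ** g n))).
    - apply (islim_minus U HU); apply (ulimP U HU _ 1); auto.
    - destruct (ball_exhausts (g n) (proj1 (Hg' n))) as [m0 Hm0].
      intros eps He. destruct (archimed_cor1 eps He) as [N [HNe HN0]].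
      apply (ultra_mono _ HU _ _ (proj2 HN (Nat.max m0 N))). intros t Ht. rewrite Rminus_0_r.
      specialize (Hi t). destruct (Hrp (i t)) as (_ & _ & hcl).
      eapply Rlt_trans; [apply hcl, Hm0; lia|]. eapply Rlt_trans; [|exact HNe].
      apply lt_0_INR in HN0. assert (INR N <= INR (i t)) by (apply le_INR; lia).
      apply Rinv_lt_contravar; [apply Rmult_lt_0_compat|]; lra. }
  rewrite !Hswap, Hzero in Hlow. lra.
Qed.

Lemma liouville s : In s S -> h (x ** s) = h x.
Proof.
  intro Hs. apply NNPP. intro Hne.
  pose proof (variance_pos HG S HS h h_bound h_harmonic x s Hs Hne) as HV.
  pose proof variance_zero. unfold V in *. lra.
Qed.

End Liouville.

(** * Invariant means *)

Lemma CV_scal c p l : Un_cv p l -> Un_cv (fun n => c * p n) (c * l).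
Proof.
  intro H. apply (CV_mult (fun _ => c)); [|exact H].
  intros eps He. exists 0%nat. intros. unfold Rdist. now rewrite Rminus_diag, Rabs_R0.
Qed.

Lemma double_limit_scal {X Y : Type} (F : X -> Y -> R) c :
  c <> 0 -> double_limit F -> double_limit (fun x y => c * F x y).
Proof.
  intros Hc HF a b li lj l1 l2 h1 h2 h3 h4.
  assert (un : forall p l, Un_cv (fun n => c * p n) l -> Un_cv p (/ c * l)).
  { intros p l H. apply (CV_scal (/ c)) in H.
    replace p with (fun n => / c * (c * p n)); [exact H|].
    apply functional_extensionality. intro. field. exact Hc. }
  apply Rmult_eq_reg_l with (/ c); [|now apply Rinv_neq_0_compat].
  apply (HF a b (fun i => / c * li i) (fun j => / c * lj j)); auto using CV_scal.
Qed.

(** The approximant may have no limits along the given sequences. Being bounded, it has ultrafilter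
    limits, which agree in both orders and lie within [eps / 3] of those of [F]. *)
Lemma double_limit_approx {X Y : Type} (F : X -> Y -> R) :
  (forall eps, 0 < eps -> exists F', double_limit F' /\ (exists B, forall x y, Rabs (F' x y) <= B) /\
     forall x y, Rabs (F x y - F' x y) <= eps) ->
  double_limit F.
Proof.
  intros H a b li lj l1 l2 h1 h2 h3 h4.
  apply cond_eq. intros eps He.
  destruct (H (eps / 3) ltac:(lra)) as (F' & HF' & [B HB] & HFF').
  destruct nonprincipal_exists as [U HN]. pose proof (proj1 HN) as HU.
  assert (near : forall p q x y, (forall n : nat, Rabs (p n - q n) <= eps / 3) ->
     islim U p x -> islim U q y -> Rabs (x - y) <= eps / 3).
  { intros p q x y Hpq Hp Hq. apply (islim_bound U HU (fun n => p n - q n)); [exact Hpq|].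
    now apply (islim_minus U HU). }
  set (phi := fun i => ulim U (fun j => F' (a i) (b j))).
  set (psi := fun j => ulim U (fun i => F' (a i) (b j))).
  assert (Hphi : forall i, islim U (fun j => F' (a i) (b j)) (phi i))
    by (intro; apply (ulimP U HU _ B); auto).
  assert (Hpsi : forall j, islim U (fun i => F' (a i) (b j)) (psi j))
    by (intro; apply (ulimP U HU _ B); auto).
  assert (Ha : islim U phi (ulim U phi)).
  { apply (ulimP U HU _ B). intro. apply (ulim_bound U HU). auto. }
  assert (Hb : islim U psi (ulim U psi)).
  { apply (ulimP U HU _ B). intro. apply (ulim_bound U HU). auto. }
  pose proof (double_limit_ultra (fun i j => F' (a i) (b j)) U U phi psi _ _
    (double_limit_comp F' a b HF') HU HU Hphi Ha Hpsi Hb) as E.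
  assert (E1 : Rabs (l1 - ulim U phi) <= eps / 3).
  { apply (near li phi); [|now apply islim_cv|exact Ha]. intro i.
    apply (near (fun j => F (a i) (b j)) (fun j => F' (a i) (b j))); auto.
    now apply islim_cv. }
  assert (E2 : Rabs (l2 - ulim U psi) <= eps / 3).
  { apply (near lj psi); [|now apply islim_cv|exact Hb]. intro j.
    apply (near (fun i => F (a i) (b j)) (fun i => F' (a i) (b j))); auto.
    now apply islim_cv. }
  rewrite E in E1. apply Rabs_le_bounds in E1. apply Rabs_le_bounds in E2. apply Rabs_def1; lra.
Qed.

Section Amenable.
Context {G : Type} {mul : G -> G -> G} {one : G} {inv : G -> G} (HG : group_laws mul one inv).
Local Notation "x ** y" := (mul x y) (at level 40, left associativity).

(** Weak almost periodicity, expressed by Grothendieck's double limit criterion. *)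
Definition wap (f : G -> R) : Prop := bdd f /\ double_limit (fun x y => f (x ** y)).

(** For a stationary mean, the Liouville theorem at the identity says that [f] and its translate by
    a step have the same mean. *)
Lemma finitely_invariant_mean (S : list G) :
  exists C, mean (fun _ : G => True) C /\
    forall f s, wap f -> In s S -> C (fun x => f (s ** x)) = C f.
Proof.
  (* Adding the identity to the steps makes the list nonempty. *)
  destruct (stationary_mean HG (one :: S) ltac:(discriminate)) as (C & HC & Cinv).
  exists C. split.
  { constructor; [apply (mean_lin _ _ HC)| |apply (mean_one _ _ HC)].
    intros p q Hp Hq H. apply (mean_mono _ _ HC); auto. }
  intros f s [[B HB] Hf] Hs.
  assert (HB0 : 0 <= B) by (eapply Rle_trans; [apply Rabs_pos|apply (HB one)]).
  (* Rescaling [f] brings it within the bound [1] assumed by the Liouville theorem. *)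
  set (c := / (B + 1)).
  assert (Hc : 0 < c) by (apply Rinv_0_lt_compat; lra).
  assert (f1 : forall g, Rabs (c * f g) <= 1).
  { intro g. rewrite Rabs_mult, (Rabs_right c) by lra. specialize (HB g).
    apply Rle_trans with (c * (B + 1)).
    - apply Rmult_le_compat_l; lra.
    - unfold c. right. field. lra. }
  assert (Bf : forall k : G -> G, bdd (fun w => f (k w))) by (intro; now exists B).
  assert (L := liouville HG (one :: S) ltac:(discriminate) (fun g => c * f g) f1
    (double_limit_scal _ c ltac:(lra) Hf) C HC Cinv one s (or_intror Hs)).
  simpl in L. rewrite !(mean_scal HC) in L by apply Bf.
  apply Rmult_eq_reg_l in L; [|lra].
  rewrite (grp_one_l _ _ _ HG) in L. rewrite L. f_equal.
  apply functional_extensionality. intro w. now rewrite (grp_one_l _ _ _ HG).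
Qed.

(** The means for finite sets of steps are combined along an ultrafilter on lists for which almost
    every list includes any given one; each translation is thus eventually among the steps. *)
Lemma wap_invariant_mean :
  exists m, mean (fun _ : G => True) m /\
    forall f s, wap f -> m (fun x => f (s ** x)) = m f.
Proof.
  set (C := fun S => proj1_sig (constructive_indefinite_description _ (finitely_invariant_mean S))).
  assert (HC : forall S, mean (fun _ : G => True) (C S) /\
    forall f s, wap f -> In s S -> C S (fun x => f (s ** x)) = C S f)
    by (intro S; exact (proj2_sig (constructive_indefinite_description _ (finitely_invariant_mean S)))).
  clearbody C.
  destruct (ultra_exists (fun A : list G -> Prop => exists l, forall S, incl l S -> A S)) as [U [HU HF]].
  - now exists [].
  - intros A B [l Hl] [l' Hl']. exists (l ++ l'). intros S HS. split.
    + apply Hl. intros z Hz. apply HS, in_or_app. now left.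
    + apply Hl'. intros z Hz. apply HS, in_or_app. now right.
  - intros A [l Hl]. exists l. apply Hl, incl_refl.
  - exists (fun f => ulim U (fun S => C S f)). split.
    + apply mean_ulim; [exact HU|]. apply HC.
    + intros f s Hf. apply (islim_ulim U HU).
      apply (islim_ext U HU (fun S => C S f)).
      * apply HF. exists [s]. intros S HS. symmetry. apply HC; [exact Hf|]. apply HS. now left.
      * destruct (proj1 Hf) as [B HB]. apply (ulimP U HU _ B). intro S.
        now apply (mean_bound (proj1 (HC S))).
Qed.

End Amenable.

(** * Formulas and definable predicates *)

(** The choice operator in [Rsup_set] yields the true supremum because the family is bounded and, by
    [x0], nonempty. *)
Lemma Rsup_family {X : Type} (x0 : X) (p : X -> R) B :
  (forall x, Rabs (p x) <= B) ->
  (forall x, p x <= Rsup_set (fun r => exists x, r = p x)) /\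
  (forall c, (forall x, p x <= c) -> Rsup_set (fun r => exists x, r = p x) <= c).
Proof.
  intro HB.
  assert (H : is_lub (fun r => exists x, r = p x) (Rsup_set (fun r => exists x, r = p x))).
  { unfold Rsup_set. apply epsilon_spec.
    destruct (completeness (fun r => exists x, r = p x)) as [s Hs].
    - exists B. intros r [x ->]. apply Rabs_le_bounds, HB.
    - now exists (p x0), x0.
    - now exists s. }
  destruct H as [h1 h2]. split.
  - intro x. apply h1. now exists x.
  - intros c Hc. apply h2. intros r [x ->]. apply Hc.
Qed.

Lemma Rinf_family {X : Type} (x0 : X) (p : X -> R) B :
  (forall x, Rabs (p x) <= B) ->
  (forall x, Rinf_set (fun r => exists x, r = p x) <= p x) /\
  (forall c, (forall x, c <= p x) -> c <= Rinf_set (fun r => exists x, r = p x)).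
Proof.
  intro HB. unfold Rinf_set.
  replace (fun r => exists x, - r = p x) with (fun r => exists x, r = - p x).
  - destruct (Rsup_family x0 (fun x => - p x) B) as [h1 h2].
    { intro x. now rewrite Rabs_Ropp. }
    split.
    + intro x. specialize (h1 x). simpl in h1. lra.
    + intros c Hc. enough (Rsup_set (fun r => exists x, r = - p x) <= - c) by lra.
      apply h2. intro x. specialize (Hc x). lra.
  - apply functional_extensionality. intro r. apply PropExtensionality.propositional_extensionality.
    split; intros [x Hx]; exists x; lra.
Qed.

Lemma uniform_min (P : nat -> R -> Prop) k :
  (forall i d d', P i d -> 0 < d' -> d' <= d -> P i d') ->
  (forall i, (i < k)%nat -> exists d, 0 < d /\ P i d) ->
  exists d, 0 < d /\ forall i, (i < k)%nat -> P i d.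
Proof.
  intros Hmono. induction k as [|k IH]; intro H.
  - exists 1. split; [lra|]. intros; lia.
  - destruct IH as (d & Hd & HP); [intros; apply H; lia|].
    destruct (H k (Nat.lt_succ_diag_r k)) as (d' & Hd' & HP').
    assert (Hm : 0 < Rmin d d') by now apply Rmin_glb_lt.
    exists (Rmin d d'). split; [exact Hm|]. intros i Hi.
    destruct (Nat.eq_dec i k) as [->|Hne].
    + apply (Hmono k d'); auto. apply Rmin_r.
    + apply (Hmono i d); auto; [apply HP; lia|apply Rmin_l].
Qed.

Lemma uniform_max (P : nat -> R -> Prop) k :
  (forall i d d', P i d -> d <= d' -> P i d') ->
  (forall i, (i < k)%nat -> exists d, P i d) ->
  exists d, forall i, (i < k)%nat -> P i d.
Proof.
  intros Hmono. induction k as [|k IH]; intro H.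
  - exists 1. intros; lia.
  - destruct IH as (d & HP); [intros; apply H; lia|].
    destruct (H k (Nat.lt_succ_diag_r k)) as (d' & HP').
    exists (Rmax d d'). intros i Hi.
    destruct (Nat.eq_dec i k) as [->|Hne].
    + apply (Hmono k d'); auto. apply Rmax_r.
    + apply (Hmono i d); auto; [apply HP; lia|apply Rmax_l].
Qed.

(** Compactness of the cube with side from [-B] to [B]: its sequences converge along an ultrafilter,
    uniformly in the [k] coordinates. Applied to sequences of counterexamples, it makes connectives
    bounded and uniformly continuous there. *)
Lemma box_limit U k (v : nat -> nat -> R) B :
  ultra U -> (forall n i, (i < k)%nat -> Rabs (v n i) <= B) ->
  forall d, 0 < d ->
  U (fun n => forall i, (i < k)%nat -> Rabs (ulim U (fun n => v n i) - v n i) < d).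
Proof.
  intros HU HB d Hd.
  apply (ultra_mono _ HU (fun n => forall i, In i (seq 0 k) -> Rabs (v n i - ulim U (fun n => v n i)) < d)).
  - apply (ultra_list U HU _ (fun i n => Rabs (v n i - ulim U (fun n => v n i)) < d)).
    intros i Hi. apply in_seq in Hi. apply (ulimP U HU _ B); [|exact Hd].
    intro n. apply HB. lia.
  - intros n H i Hi. rewrite Rabs_minus_sym. apply H. apply in_seq. lia.
Qed.

Lemma connective_bounded k u B : connective k u ->
  exists K, forall v, (forall i, (i < k)%nat -> Rabs (v i) <= B) -> Rabs (u v) <= K.
Proof.
  intros [_ Hu]. apply NNPP. intro Hno.
  assert (Hv : forall n : nat, exists v, (forall i, (i < k)%nat -> Rabs (v i) <= B) /\ INR n < Rabs (u v)).
  { intro n. apply NNPP. intro Hn. apply Hno. exists (INR n). intros v Hv.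
    apply Rnot_lt_le. intro Hlt. apply Hn. now exists v. }
  set (v := fun n => proj1_sig (constructive_indefinite_description _ (Hv n))).
  assert (Hv' : forall n, (forall i, (i < k)%nat -> Rabs (v n i) <= B) /\ INR n < Rabs (u (v n)))
    by (intro n; exact (proj2_sig (constructive_indefinite_description _ (Hv n)))).
  destruct nonprincipal_exists as [U [HU HT]].
  set (l := fun i => ulim U (fun n => v n i)).
  destruct (Hu l 1 ltac:(lra)) as (d & Hd & H).
  destruct (INR_unbounded (Rabs (u l) + 1)) as [N HN].
  destruct (ultra_ne _ HU _ (ultra_and _ HU _ _ (HT N)
    (box_limit U k v B HU (fun n => proj1 (Hv' n)) d Hd))) as [n [Hn Hcl]].
  specialize (H (v n) Hcl). destruct (Hv' n) as [_ Hbig].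
  assert (INR N <= INR n) by now apply le_INR.
  pose proof (Rabs_triang (u l) (- (u l - u (v n)))) as T.
  rewrite Rabs_Ropp in T. replace (u l + - (u l - u (v n))) with (u (v n)) in T by ring. lra.
Qed.

Lemma connective_uniform k u B eps : connective k u -> 0 < eps ->
  exists d, 0 < d /\ forall v w,
    (forall i, (i < k)%nat -> Rabs (v i) <= B) -> (forall i, (i < k)%nat -> Rabs (w i) <= B) ->
    (forall i, (i < k)%nat -> Rabs (v i - w i) < d) -> Rabs (u v - u w) <= eps.
Proof.
  intros [_ Hu] He. apply NNPP. intro Hno.
  assert (Hv : forall n : nat, exists vw : (nat -> R) * (nat -> R),
    (forall i, (i < k)%nat -> Rabs (fst vw i) <= B) /\ (forall i, (i < k)%nat -> Rabs (snd vw i) <= B) /\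
    (forall i, (i < k)%nat -> Rabs (fst vw i - snd vw i) < / (INR n + 1)) /\
    eps < Rabs (u (fst vw) - u (snd vw))).
  { intro n. apply NNPP. intro Hn. apply Hno. exists (/ (INR n + 1)).
    split; [apply inv_INR_pos|]. intros v w h1 h2 h3.
    apply Rnot_lt_le. intro Hlt. apply Hn. now exists (v, w). }
  set (s := fun n => proj1_sig (constructive_indefinite_description _ (Hv n))).
  assert (Hs := fun n => proj2_sig (constructive_indefinite_description _ (Hv n))).
  fold s in Hs. cbv beta in Hs.
  destruct nonprincipal_exists as [U [HU HT]].
  set (l := fun i => ulim U (fun n => fst (s n) i)).
  destruct (Hu l (eps / 2) ltac:(lra)) as (d & Hd & H).
  destruct (archimed_cor1 (d / 2) ltac:(lra)) as [N [HN HN0]].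
  destruct (ultra_ne _ HU _ (ultra_and _ HU _ _ (HT N)
    (box_limit U k (fun n => fst (s n)) B HU (fun n => proj1 (Hs n)) (d / 2) ltac:(lra)))) as [n [Hn Hcl]].
  destruct (Hs n) as (_ & _ & Hnear & Hfar). fold (s n) in Hnear, Hfar.
  assert (Hinv : / (INR n + 1) < d / 2).
  { eapply Rlt_trans; [|exact HN]. apply lt_0_INR in HN0.
    assert (INR N <= INR n) by now apply le_INR.
    apply Rinv_lt_contravar; [apply Rmult_lt_0_compat|]; lra. }
  assert (A1 : Rabs (u l - u (fst (s n))) < eps / 2).
  { apply H. intros i Hi. specialize (Hcl i Hi). unfold l. lra. }
  assert (A2 : Rabs (u l - u (snd (s n))) < eps / 2).
  { apply H. intros i Hi. specialize (Hcl i Hi). specialize (Hnear i Hi).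
    replace (l i - snd (s n) i) with ((l i - fst (s n) i) + (fst (s n) i - snd (s n) i)) by ring.
    eapply Rle_lt_trans; [apply Rabs_triang|]. unfold l. lra. }
  apply Rabs_def2 in A1. apply Rabs_def2 in A2.
  assert (Rabs (u (fst (s n)) - u (snd (s n))) < eps) by (apply Rabs_def1; lra). lra.
Qed.

(** * Boundedness, uniform continuity and renaming of variables for formulas in a metric
    structure *)

Section Metric.
Context {L : signature} (M : structure L) (HM : metric_structure M).

Let d01 : forall x y, 0 <= dist M x y <= 1 := proj1 HM.
Let dsym : forall x y, dist M x y = dist M y x := proj1 (proj2 (proj2 HM)).
Let dtri : forall x y z, dist M x z <= dist M x y + dist M y z := proj1 (proj2 (proj2 (proj2 HM))).

Lemma dist_refl x : dist M x x = 0.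
Proof. now apply (proj1 (proj2 HM)). Qed.

Lemma term_uniform (t : term L) eps : 0 < eps ->
  exists del, 0 < del /\ forall v w, (forall k, dist M (v k) (w k) < del) ->
    dist M (teval M v t) (teval M w t) < eps.
Proof.
  revert eps. induction t as [k|g ts IH]; intros eps He.
  - exists eps. split; [exact He|]. intros v w H. apply H.
  - pose proof HM as (_ & _ & _ & _ & _ & _ & Hfun & _).
    destruct (Hfun g (eps / 2) ltac:(lra)) as [Hpos Hmod].
    destruct (uniform_min (fun i del => forall v w, (forall k, dist M (v k) (w k) < del) ->
      dist M (teval M v (ts i)) (teval M w (ts i)) < fmod L g (eps / 2)) (farity L g)) as (del & Hd & H).
    + intros i d d' H Hd' Hle v w Hvw. apply H. intro k. specialize (Hvw k). lra.
    + intros i _. now apply IH.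
    + exists del. split; [exact Hd|]. intros v w Hvw. simpl.
      apply Rle_lt_trans with (eps / 2); [|lra]. apply Hmod. intros i Hi. now apply H.
Qed.

Lemma formula_bounded (phi : formula L) : wf_formula phi ->
  exists B, forall v, Rabs (eval M v phi) <= B.
Proof.
  pose proof HM as (_ & _ & _ & _ & _ & _ & _ & Hpred & _).
  induction phi as [t s|P ts|k u ps IH|x p IH|x p IH]; simpl; intro Hwf.
  - exists 1. intro v. pose proof (d01 (teval M v t) (teval M v s)). apply Rabs_le. lra.
  - exists 1. intro v. specialize (Hpred P (fun i => teval M v (ts i))). apply Rabs_le. lra.
  - destruct Hwf as [Hu Hps].
    destruct (uniform_max (fun i B => forall v, Rabs (eval M v (ps i)) <= B) k) as [B HB].
    + intros i d d' H Hle v. specialize (H v). lra.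
    + intros i Hi. auto.
    + destruct (connective_bounded k u B Hu) as [K HK]. exists K. intro v. apply HK. intros i Hi. now apply HB.
  - destruct (IH Hwf) as [B HB]. exists B. intro v.
    destruct (Rsup_family (point M) (fun a => eval M (upd v x a) p) B) as [h1 h2]; [auto|].
    apply Rabs_le. split.
    + eapply Rle_trans; [|apply (h1 (point M))]. apply (Rabs_le_bounds _ _ (HB (upd v x (point M)))).
    + apply h2. intro a. apply (Rabs_le_bounds _ _ (HB (upd v x a))).
  - destruct (IH Hwf) as [B HB]. exists B. intro v.
    destruct (Rinf_family (point M) (fun a => eval M (upd v x a) p) B) as [h1 h2]; [auto|].
    apply Rabs_le. split.
    + apply h2. intro a. apply (Rabs_le_bounds _ _ (HB (upd v x a))).
    + eapply Rle_trans; [apply (h1 (point M))|]. apply (Rabs_le_bounds _ _ (HB (upd v x (point M)))).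
Qed.

Lemma upd_close (v w : nat -> M) x a del : 0 < del ->
  (forall k, dist M (v k) (w k) < del) -> forall k, dist M (upd v x a k) (upd w x a k) < del.
Proof.
  intros Hd H k. unfold upd. destruct (Nat.eqb k x); [|apply H]. now rewrite dist_refl.
Qed.

(** Connectives are uniformly continuous on a cube containing the values of their arguments, and
    suprema and infima preserve a modulus of continuity. *)
Lemma formula_uniform (phi : formula L) : wf_formula phi -> forall eps, 0 < eps ->
  exists del, 0 < del /\ forall v w, (forall k, dist M (v k) (w k) < del) ->
    Rabs (eval M v phi - eval M w phi) <= eps.
Proof.
  induction phi as [t s|P ts|k u ps IH|x p IH|x p IH]; simpl; intros Hwf eps He.
  - destruct (term_uniform t (eps / 2) ltac:(lra)) as (d1 & Hd1 & H1).
    destruct (term_uniform s (eps / 2) ltac:(lra)) as (d2 & Hd2 & H2).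
    exists (Rmin d1 d2). split; [now apply Rmin_glb_lt|]. intros v w Hvw.
    assert (A1 := H1 v w (fun k => Rlt_le_trans _ _ _ (Hvw k) (Rmin_l _ _))).
    assert (A2 := H2 v w (fun k => Rlt_le_trans _ _ _ (Hvw k) (Rmin_r _ _))).
    set (t1 := teval M v t) in *. set (t2 := teval M w t) in *.
    set (s1 := teval M v s) in *. set (s2 := teval M w s) in *.
    pose proof (dtri t1 t2 s1). pose proof (dtri t2 s2 s1).
    pose proof (dtri t2 t1 s2). pose proof (dtri t1 s1 s2).
    rewrite (dsym t2 t1) in *. rewrite (dsym s2 s1) in *.
    apply Rabs_le. lra.
  - pose proof HM as (_ & _ & _ & _ & _ & _ & _ & _ & _ & Hpred).
    destruct (Hpred P eps He) as [Hpos Hmod].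
    destruct (uniform_min (fun i del => forall v w, (forall k, dist M (v k) (w k) < del) ->
      dist M (teval M v (ts i)) (teval M w (ts i)) < pmod L P eps) (parity L P)) as (del & Hd & H).
    + intros i d d' H Hd' Hle v w Hvw. apply H. intro k. specialize (Hvw k). lra.
    + intros i _. now apply term_uniform.
    + exists del. split; [exact Hd|]. intros v w Hvw. apply Hmod. intros i Hi. now apply H.
  - destruct Hwf as [Hu Hps].
    destruct (uniform_max (fun i B => forall v, Rabs (eval M v (ps i)) <= B) k) as [B HB].
    { intros i d d' H Hle v. specialize (H v). lra. }
    { intros i Hi. apply formula_bounded. auto. }
    destruct (connective_uniform k u B eps Hu He) as (eta & Heta & Hunif).
    destruct (uniform_min (fun i del => forall v w, (forall k, dist M (v k) (w k) < del) ->
      Rabs (eval M v (ps i) - eval M w (ps i)) <= eta / 2) k) as (del & Hd & H).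
    + intros i d d' H Hd' Hle v w Hvw. apply H. intro j. specialize (Hvw j). lra.
    + intros i Hi. apply IH; auto. lra.
    + exists del. split; [exact Hd|]. intros v w Hvw. apply Hunif; intros i Hi; try now apply HB.
      specialize (H i Hi v w Hvw). lra.
  - destruct (IH Hwf eps He) as (del & Hd & H). exists del. split; [exact Hd|]. intros v w Hvw.
    destruct (formula_bounded p Hwf) as [B HB].
    destruct (Rsup_family (point M) (fun a => eval M (upd v x a) p) B) as [h1 h2]; [auto|].
    destruct (Rsup_family (point M) (fun a => eval M (upd w x a) p) B) as [h3 h4]; [auto|].
    assert (N := fun a => Rabs_le_bounds _ _ (H _ _ (upd_close v w x a del Hd Hvw))).
    set (s1 := Rsup_set (fun r => exists a : M, r = eval M (upd v x a) p)) in *.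
    set (s2 := Rsup_set (fun r => exists a : M, r = eval M (upd w x a) p)) in *.
    assert (s1 <= s2 + eps) by (apply h2; intro a; specialize (h3 a); specialize (N a); simpl in *; lra).
    assert (s2 <= s1 + eps) by (apply h4; intro a; specialize (h1 a); specialize (N a); simpl in *; lra).
    apply Rabs_le. lra.
  - destruct (IH Hwf eps He) as (del & Hd & H). exists del. split; [exact Hd|]. intros v w Hvw.
    destruct (formula_bounded p Hwf) as [B HB].
    destruct (Rinf_family (point M) (fun a => eval M (upd v x a) p) B) as [h1 h2]; [auto|].
    destruct (Rinf_family (point M) (fun a => eval M (upd w x a) p) B) as [h3 h4]; [auto|].
    assert (N := fun a => Rabs_le_bounds _ _ (H _ _ (upd_close v w x a del Hd Hvw))).
    set (s1 := Rinf_set (fun r => exists a : M, r = eval M (upd v x a) p)) in *.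
    set (s2 := Rinf_set (fun r => exists a : M, r = eval M (upd w x a) p)) in *.
    assert (s2 - eps <= s1) by (apply h2; intro a; specialize (h3 a); specialize (N a); simpl in *; lra).
    assert (s1 - eps <= s2) by (apply h4; intro a; specialize (h1 a); specialize (N a); simpl in *; lra).
    apply Rabs_le. lra.
Qed.

Fixpoint term_rename (r : nat -> nat) (t : term L) : term L :=
  match t with
  | TVar k => TVar (r k)
  | TApp g ts => TApp g (fun i => term_rename r (ts i))
  end.

(* Bound variables are renamed as well; this is sound because [r] is injective. *)
Fixpoint rename (r : nat -> nat) (phi : formula L) : formula L :=
  match phi with
  | FDist t s => FDist (term_rename r t) (term_rename r s)
  | FPred P ts => FPred P (fun i => term_rename r (ts i))
  | FConn k u ps => FConn k u (fun i => rename r (ps i))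
  | FSup x p => FSup (r x) (rename r p)
  | FInf x p => FInf (r x) (rename r p)
  end.

Lemma rename_wf r phi : wf_formula phi -> wf_formula (rename r phi).
Proof. induction phi; simpl; intuition auto. Qed.

Lemma teval_rename r v t : teval M v (term_rename r t) = teval M (fun k => v (r k)) t.
Proof.
  induction t as [k|g ts IH]; simpl; [reflexivity|].
  f_equal. now apply functional_extensionality.
Qed.

Lemma eval_rename r phi v : (forall i j, r i = r j -> i = j) ->
  eval M v (rename r phi) = eval M (fun k => v (r k)) phi.
Proof.
  intro Hr.
  assert (U : forall v x a, (fun k => upd v (r x) a (r k)) = upd (M := M) (fun k => v (r k)) x a).
  { intros w x a. apply functional_extensionality. intro k. unfold upd.
    destruct (Nat.eqb_spec k x) as [->|Hne]; [now rewrite Nat.eqb_refl|].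
    destruct (Nat.eqb_spec (r k) (r x)) as [E|_]; [|reflexivity]. exfalso. auto. }
  revert v. induction phi as [t s|P ts|k u ps IH|x p IH|x p IH]; intro v; simpl.
  - now rewrite !teval_rename.
  - f_equal. apply functional_extensionality. intro. apply teval_rename.
  - f_equal. apply functional_extensionality. auto.
  - f_equal. apply functional_extensionality. intro q.
    f_equal. apply functional_extensionality. intro a. now rewrite IH, U.
  - f_equal. apply functional_extensionality. intro q.
    f_equal. apply functional_extensionality. intro a. now rewrite IH, U.
Qed.

Definition infs (l : list nat) (phi : formula L) : formula L := fold_right FInf phi l.

Lemma infs_wf l phi : wf_formula phi -> wf_formula (infs l phi).
Proof. intro H. now induction l. Qed.

(** Together with [infs_le], this identifies the iterated infimum with the joint infimum over all
    assignments that agree with [v] outside [l]. *)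
Lemma infs_ge l phi v c : wf_formula phi ->
  (forall v' : nat -> M, (forall k, ~ In k l -> v' k = v k) -> c <= eval M v' phi) ->
  c <= eval M v (infs l phi).
Proof.
  intro Hwf. revert v. induction l as [|x l IH]; intros v H; simpl.
  - apply H. reflexivity.
  - destruct (formula_bounded _ (infs_wf l phi Hwf)) as [B HB].
    destruct (Rinf_family (point M) (fun a => eval M (upd v x a) (infs l phi)) B) as [_ h2]; [auto|].
    apply h2. intro a. apply IH. intros v' Hv'. apply H. intros k Hk.
    rewrite Hv' by (simpl in Hk; tauto). unfold upd.
    destruct (Nat.eqb_spec k x) as [->|]; [|reflexivity]. exfalso. apply Hk. now left.
Qed.

Lemma infs_le l phi v v' : wf_formula phi -> (forall k, ~ In k l -> v' k = v k) ->
  eval M v (infs l phi) <= eval M v' phi.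
Proof.
  intro Hwf. revert v. induction l as [|x l IH]; intros v H; simpl.
  - replace v' with v; [lra|]. apply functional_extensionality. intro k. symmetry. now apply H.
  - destruct (formula_bounded _ (infs_wf l phi Hwf)) as [B HB].
    destruct (Rinf_family (point M) (fun a => eval M (upd v x a) (infs l phi)) B) as [h1 _]; [auto|].
    eapply Rle_trans; [apply (h1 (v' x))|]. apply IH. intros k Hk. unfold upd.
    destruct (Nat.eqb_spec k x) as [->|Hne]; [reflexivity|]. apply H. simpl. intuition.
Qed.

Lemma place_at n off (a : tuple M n) v (j : Fin.t n) :
  place n off a v (off + proj1_sig (Fin.to_nat j)) = a j.
Proof.
  unfold place. pose proof (proj2_sig (Fin.to_nat j)) as Hj. simpl in Hj.
  destruct (le_lt_dec off _) as [_|]; [|lia].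
  destruct (lt_dec _ n) as [h|]; [|lia].
  f_equal. apply Fin.to_nat_inj. rewrite Fin.to_nat_of_nat. simpl. lia.
Qed.

Lemma place_out n off (a : tuple M n) v k : (k < off \/ off + n <= k)%nat -> place n off a v k = v k.
Proof.
  intro H. unfold place. destruct (le_lt_dec off k); [|reflexivity].
  destruct (lt_dec _ n); [lia|reflexivity].
Qed.

Lemma fin_index n off k : (off <= k < off + n)%nat ->
  exists j : Fin.t n, k = (off + proj1_sig (Fin.to_nat j))%nat.
Proof.
  intro H. assert (h : (k - off < n)%nat) by lia.
  exists (Fin.of_nat_lt h). rewrite Fin.to_nat_of_nat. simpl. lia.
Qed.

Lemma dmax_dist n (a b : tuple M n) j : dist M (a j) (b j) <= dmax M n a b.
Proof.
  induction n as [|n IH]; [now apply Fin.case0|]. simpl.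
  apply (Fin.caseS' j).
  - apply Rmax_l.
  - intro i. eapply Rle_trans; [|apply Rmax_r]. exact (IH (fun i => a (Fin.FS i)) (fun i => b (Fin.FS i)) i).
Qed.

Lemma dmax_ge0 n (a b : tuple M n) : 0 <= dmax M n a b.
Proof.
  destruct n; simpl; [lra|]. eapply Rle_trans; [|apply Rmax_l]. apply d01.
Qed.

Lemma dmax_refl n (a : tuple M n) : dmax M n a a = 0.
Proof.
  induction n as [|n IH]; simpl; [reflexivity|].
  rewrite dist_refl, (IH (fun i => a (Fin.FS i))). now apply Rmax_left.
Qed.

Lemma definable_pred_bounded n P : definable_pred M n P -> bdd P.
Proof.
  intro HP. destruct (HP 1 ltac:(lra)) as (phi & c & Hwf & H).
  destruct (formula_bounded phi Hwf) as [B HB]. exists (B + 1). intro a.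
  specialize (H a). specialize (HB (place n 0 a c)).
  apply Rabs_le_bounds in H. apply Rabs_le_bounds in HB. apply Rabs_le. lra.
Qed.

(** * The double limit property of [P (x y)] on the group *)

Section Product.
Context (Hst : forall (phi : formula L) sel, wf_formula phi -> stable_formula_in M phi sel)
  (n : nat) (G : tuple M n -> Prop) (mul : tuple M n -> tuple M n -> tuple M n)
  (Q : tuple M n -> tuple M n -> tuple M n -> R) (HQ : definable_pred3 M n Q)
  (HQmul : forall x y z, G x -> G y -> Q x y z = dmax M n (mul x y) z)
  (P : tuple M n -> R) (HP : definable_pred M n P).

(* Free variables of the formula below: position [2 i] carries [x_i] for [i < n], [y_(i-n)] for
   [n <= i < 2 n], [z_(i-2n)] for [2 n <= i < 3 n], and parameters beyond; the odd positions
   carry the parameters of [phi]. *)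
Let left_var (k : nat) : bool := andb (Nat.even k) (Nat.div2 k <? n)%nat.
Let zpos (k : nat) : nat := (2 * (n + n + k))%nat.
(** Under these renamings [phi] is read at [z] with its parameters [c], and [psi] at [x, y, z] with
    its parameters [c']; parity keeps the two lists of parameters apart. *)
Let rphi (k : nat) : nat := if (k <? n)%nat then zpos k else (2 * k + 1)%nat.
Let rpsi (k : nat) : nat := (2 * k)%nat.
Let zvars : list nat := map zpos (seq 0 n).
(** The form required by [stable_formula_in]: for fixed parameters, the first argument of [mix]
    depends only on [x] and the second only on [y]. *)
Let assign (c c' : nat -> M) (x y : tuple M n) : nat -> M :=
  mix left_var (fun k => place n 0 x c (Nat.div2 k))
    (fun k => if Nat.even k then place n n y c' (Nat.div2 k) else c (Nat.div2 k)).

Lemma div2_odd k : Nat.div2 (2 * k + 1) = k.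
Proof. rewrite Nat.add_1_r. apply Nat.div2_succ_double. Qed.

Lemma even_odd k : Nat.even (2 * k + 1) = false.
Proof. now rewrite Nat.even_odd. Qed.

Lemma assign_even c c' x y i : assign c c' x y (2 * i) = place n 0 x (place n n y c') i.
Proof.
  unfold assign, mix, left_var. rewrite Nat.even_even, Nat.div2_double. simpl.
  destruct (Nat.ltb_spec i n) as [h|h].
  - destruct (fin_index n 0 i ltac:(lia)) as [j ->]. now rewrite !place_at.
  - rewrite (place_out n 0) by lia. reflexivity.
Qed.

Lemma assign_odd c c' x y i : assign c c' x y (2 * i + 1) = c i.
Proof. unfold assign, mix, left_var. now rewrite even_odd, div2_odd. Qed.

Lemma in_zvars k : In k zvars <-> exists i, (i < n)%nat /\ k = zpos i.
Proof.
  unfold zvars. rewrite in_map_iff. split.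
  - intros [i [<- Hi]]. apply in_seq in Hi. exists i. split; [lia|reflexivity].
  - intros [i [Hi ->]]. exists i. split; [reflexivity|]. apply in_seq. lia.
Qed.

Lemma assign_phi c c' x y z (v : nat -> M) :
  (forall k, ~ In k zvars -> v k = assign c c' x y k) ->
  (forall j, v (zpos (proj1_sig (Fin.to_nat j))) = z j) ->
  (fun k => v (rphi k)) = place n 0 z c.
Proof.
  intros Hv Hz. apply functional_extensionality. intro k. unfold rphi.
  destruct (Nat.ltb_spec k n) as [h|h].
  - destruct (fin_index n 0 k ltac:(lia)) as [j ->]. rewrite place_at. apply Hz.
  - rewrite place_out by lia. rewrite Hv; [apply assign_odd|].
    rewrite in_zvars. unfold zpos. intros [i [_ E]]. lia.
Qed.

Lemma assign_psi c c' x y z (v : nat -> M) :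
  (forall k, ~ In k zvars -> v k = assign c c' x y k) ->
  (forall j, v (zpos (proj1_sig (Fin.to_nat j))) = z j) ->
  (fun k => v (rpsi k)) = place n 0 x (place n n y (place n (n + n) z c')).
Proof.
  intros Hv Hz. apply functional_extensionality. intro k. unfold rpsi.
  destruct (le_lt_dec (n + n) k) as [h|h].
  - rewrite (place_out n 0), (place_out n n) by lia.
    destruct (le_lt_dec (n + n + n) k) as [h'|h'].
    + rewrite place_out by lia. rewrite Hv, assign_even.
      * now rewrite !place_out by lia.
      * rewrite in_zvars. unfold zpos. intros [i [Hi E]]. lia.
    + destruct (fin_index n (n + n) k ltac:(lia)) as [j ->]. rewrite place_at. apply Hz.
  - rewrite Hv, assign_even by (rewrite in_zvars; unfold zpos; intros [i [Hi E]]; lia).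
    destruct (le_lt_dec n k) as [h'|h'].
    + rewrite !(place_out n 0) by lia.
      destruct (fin_index n n k ltac:(lia)) as [j ->]. now rewrite !place_at.
    + destruct (fin_index n 0 k ltac:(lia)) as [j ->]. now rewrite !place_at.
Qed.

Lemma rphi_inj i j : rphi i = rphi j -> i = j.
Proof.
  unfold rphi, zpos. destruct (Nat.ltb_spec i n), (Nat.ltb_spec j n); lia.
Qed.

Lemma connective_penalty K : connective 2 (fun v => v 0%nat + K * v 1%nat).
Proof.
  split.
  - intros v w H. rewrite !H by lia. reflexivity.
  - intros v eps He. exists (eps / (Rabs K + 2)).
    pose proof (Rabs_pos K) as HK. assert (Hd : 0 < eps / (Rabs K + 2)) by (apply Rdiv_lt_0_compat; lra).
    split; [exact Hd|]. intros w H.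
    pose proof (H 0%nat ltac:(lia)) as H0. pose proof (H 1%nat ltac:(lia)) as H1.
    replace (v 0%nat + K * v 1%nat - (w 0%nat + K * w 1%nat)) with
      ((v 0%nat - w 0%nat) + K * (v 1%nat - w 1%nat)) by ring.
    eapply Rle_lt_trans; [apply Rabs_triang|]. rewrite Rabs_mult.
    assert (Rabs K * Rabs (v 1%nat - w 1%nat) <= Rabs K * (eps / (Rabs K + 2)))
      by (apply Rmult_le_compat_l; lra).
    assert (E : (Rabs K + 2) * (eps / (Rabs K + 2)) = eps) by (field; lra). lra.
Qed.

(** The product is not a term of the language; only its distance to a variable point is definable.
    The value at the product is recovered by a penalised infimum, to which stability applies. *)
Lemma product_double_limit :
  double_limit (fun x y : {a | G a} => P (mul (proj1_sig x) (proj1_sig y))).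
Proof.
  apply double_limit_approx. intros eps He.
  destruct (HP (eps / 4) ltac:(lra)) as (phi & c & Hphi & HPphi).
  destruct (formula_bounded phi Hphi) as [B HB].
  assert (HB0 : 0 <= B) by (eapply Rle_trans; [apply Rabs_pos|apply (HB c)]).
  destruct (formula_uniform phi Hphi (eps / 4) ltac:(lra)) as (del & Hdel & Hunif).
  (* At distance [del] or more from the product, the penalty exceeds [2 * B], the largest possible
     variation of [phi]; the added [1] keeps [K] positive. *)
  set (K := (2 * B + 1) / del).
  assert (HK : 0 < K) by (apply Rdiv_lt_0_compat; lra).
  assert (HK4 : 0 < eps / (4 * K)) by (apply Rdiv_lt_0_compat; lra).
  (* The error of [psi] is multiplied by [K] in the formula, hence this precision. *)
  destruct (HQ (eps / (4 * K)) HK4) as (psi & c' & Hpsi & HQpsi).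
  (* [P (x y)] is, up to [eps], the infimum over [z] of [P z + K d (x y, z)]. *)
  set (body := FConn 2 (fun v => v 0%nat + K * v 1%nat)
    (fun i => if Nat.eqb i 0 then rename rphi phi else rename rpsi psi)).
  assert (Hbody : wf_formula body).
  { split; [apply connective_penalty|]. intros i _.
    destruct (Nat.eqb i 0); now apply rename_wf. }
  set (theta := infs zvars body).
  assert (Htheta : wf_formula theta) by now apply infs_wf.
  exists (fun x y => eval M (assign c c' (proj1_sig x) (proj1_sig y)) theta). split; [|split].
  - exact (double_limit_comp (fun a b => eval M (mix left_var a b) theta)
      (fun x k => place n 0 (proj1_sig x) c (Nat.div2 k))
      (fun y k => if Nat.even k then place n n (proj1_sig y) c' (Nat.div2 k) else c (Nat.div2 k))
      (Hst theta left_var Htheta)).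
  - destruct (formula_bounded theta Htheta) as [B' HB']. exists B'. auto.
  - intros [x Hx] [y Hy]. simpl. set (p := mul x y).
    set (F := fun z => eval M (place n 0 z c) phi).
    assert (Hev : forall v z, (forall k, ~ In k zvars -> v k = assign c c' x y k) ->
       (forall j, v (zpos (proj1_sig (Fin.to_nat j))) = z j) ->
       Rabs (eval M v body - (F z + K * dmax M n p z)) <= eps / 4).
    { intros v z Hv Hz. simpl. rewrite (eval_rename rphi) by exact rphi_inj.
      rewrite (eval_rename rpsi) by (unfold rpsi; intros; lia).
      rewrite (assign_phi c c' x y z v Hv Hz), (assign_psi c c' x y z v Hv Hz).
      specialize (HQpsi x y z). rewrite HQmul in HQpsi by assumption. fold p in HQpsi.
      unfold F. match goal with |- Rabs (?s + K * ?t - (?s + K * ?q)) <= _ =>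
        replace (s + K * t - (s + K * q)) with (K * (t - q)) by ring; set (w := t) in * end.
      rewrite Rabs_mult, Rabs_minus_sym, (Rabs_right K) by lra.
      apply Rle_trans with (K * (eps / (4 * K))).
      - apply Rmult_le_compat_l; lra.
      - right. field. lra. }
    assert (HPp := Rabs_le_bounds _ _ (HPphi p)). fold (F p) in HPp.
    (* A point [z] near [p] gives almost the value at [p] by uniform continuity; a distant one is
       excluded by the penalty. *)
    assert (Hlow : F p - eps / 2 <= eval M (assign c c' x y) theta).
    { apply infs_ge; [exact Hbody|]. intros v Hv.
      set (z := fun j : Fin.t n => v (zpos (proj1_sig (Fin.to_nat j)))).
      assert (E := Rabs_le_bounds _ _ (Hev v z Hv (fun j => eq_refl))).
      pose proof (dmax_ge0 n p z) as Hd0.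
      destruct (Rlt_le_dec (dmax M n p z) del) as [Hlt|Hge].
      - assert (Hclose : Rabs (F p - F z) <= eps / 4).
        { apply Hunif. intro k. destruct (le_lt_dec n k) as [h|h].
          - rewrite !place_out by lia. now rewrite dist_refl.
          - destruct (fin_index n 0 k ltac:(lia)) as [j ->]. rewrite !place_at.
            eapply Rle_lt_trans; [apply dmax_dist|exact Hlt]. }
        apply Rabs_le_bounds in Hclose.
        assert (0 <= K * dmax M n p z) by (apply Rmult_le_pos; lra). lra.
      - assert (2 * B + 1 <= K * dmax M n p z).
        { apply Rle_trans with (K * del); [right; unfold K; field; lra|].
          apply Rmult_le_compat_l; lra. }
        pose proof (Rabs_le_bounds _ _ (HB (place n 0 p c))) as HBp. fold (F p) in HBp.
        pose proof (Rabs_le_bounds _ _ (HB (place n 0 z c))) as HBz. fold (F z) in HBz. lra. }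
    (* The infimum is tested at [z = p], where the penalty vanishes; [v] places [p] in the positions
       of [z] and changes nothing else. *)
    assert (Hup : eval M (assign c c' x y) theta <= F p + eps / 4).
    { set (v := fun k => if Nat.even k
        then place n (n + n) p (fun i => assign c c' x y (2 * i)%nat) (Nat.div2 k)
        else assign c c' x y k).
      assert (Hv : forall k, ~ In k zvars -> v k = assign c c' x y k).
      { intros k Hk. unfold v. destruct (Nat.even k) eqn:Ek; [|reflexivity].
        apply Nat.even_spec in Ek. destruct Ek as [i ->]. rewrite Nat.div2_double.
        rewrite place_out; [reflexivity|]. apply NNPP. intro Hn. apply Hk. apply in_zvars.
        exists (i - (n + n))%nat. unfold zpos. lia. }
      assert (Hz : forall j, v (zpos (proj1_sig (Fin.to_nat j))) = p j).
      { intro j. unfold v, zpos. rewrite Nat.even_even, Nat.div2_double. apply place_at. }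
      assert (E := Rabs_le_bounds _ _ (Hev v p Hv Hz)). rewrite dmax_refl in E.
      eapply Rle_trans; [apply (infs_le zvars body _ v Hbody Hv)|]. lra. }
    apply Rabs_le. lra.
Qed.

End Product.
End Metric.

(** * The invariant mean on definable predicates *)

Lemma sig_eq {X : Type} {Z : X -> Prop} (a b : {x | Z x}) : proj1_sig a = proj1_sig b -> a = b.
Proof.
  destruct a as [a Ha], b as [b Hb]. simpl. intros <-. f_equal. apply proof_irrelevance.
Qed.

Theorem mainTheorem14 (L : signature) (T : formula L -> Prop)
  (HTwf : forall phi, T phi -> wf_formula phi)
  (Hstable : stable_theory T)
  (M : structure L) (HM : model M T)
  (n : nat) (G : tuple M n -> Prop)
  (mul : tuple M n -> tuple M n -> tuple M n)
  (inv : tuple M n -> tuple M n) (e : tuple M n)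
  (HG : definable_group M n G mul inv e) :
  definably_amenable M n G mul inv.
Proof.
  destruct HG as (_ & (Q & HQ & HQmul) & He & Hmul & Hinv & Hassoc & Hone & Hinverse).
  pose proof (proj1 HM) as Hmetric.
  (* The group laws are given only on [G]; on the subtype of its elements they hold without
     restriction. *)
  set (mulG := fun x y : {a | G a} => exist G (mul (proj1_sig x) (proj1_sig y))
    (Hmul _ _ (proj2_sig x) (proj2_sig y))).
  set (invG := fun x : {a | G a} => exist G (inv (proj1_sig x)) (Hinv _ (proj2_sig x))).
  assert (laws : group_laws mulG (exist G e He) invG).
  { constructor; intros; apply sig_eq; simpl.
    - apply Hassoc; apply proj2_sig.
    - apply Hone, proj2_sig.
    - apply Hone, proj2_sig.
    - apply Hinverse, proj2_sig.
    - apply Hinverse, proj2_sig. }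
  destruct (wap_invariant_mean laws) as (m & Hm & Hminv).
  assert (Hbdd : forall P, definable_pred M n P -> bdd (fun x : {a | G a} => P (proj1_sig x))).
  { intros P HP. apply (bdd_comp P). now apply (definable_pred_bounded M Hmetric n). }
  exists (fun P => m (fun x => P (proj1_sig x))). split; [|split; [|split; [|split]]].
  - intros P P' s t HP HP'. now apply (mean_lin _ _ Hm s t (fun x => P (proj1_sig x))
      (fun x => P' (proj1_sig x))); apply Hbdd.
  - intros P P' _ _ H. f_equal. apply functional_extensionality. intro x. apply H, proj2_sig.
  - intros P HP H. apply (mean_ge0 Hm); [now apply Hbdd|]. intros x _. apply H, proj2_sig.
  - apply (mean_one _ _ Hm).
  - intros g P P' Hg HP _ H.
    (* The predicate [g . P] is the left translate of [P] by the inverse of [g], so invariance is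
       applied to that inverse. *)
    rewrite <- (Hminv (fun x => P (proj1_sig x)) (exist G (inv g) (Hinv g Hg))).
    + f_equal. apply functional_extensionality. intro x. apply H, proj2_sig.
    + split; [now apply Hbdd|].
      apply (product_double_limit M Hmetric (Hstable M HM) n G mul Q HQ HQmul P HP).
Qed.
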